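(* Let $n\ge 1$ be an integer, let $D_{2n}=\langle \sigma,\tau \mid \sigma^n=\tau^2=e,\ \tau\sigma\tau=\sigma^{-1}\rangle$ be the dihedral group of order $2n$, and let $X=X(D_{2n},S)$ be its Cayley graph with $S=\{\sigma,\tau\}$. For each prime $p$ let $\mathcal{BF}(X_\infty)$ be the Bowen--Franks module of the constant $\mathbb{Z}_p$-tower of $X$. (1) Suppose that $n$ is odd. If $p\ne 2$, then $\mu_p(\mathcal{BF}(X_\infty))=\lambda_p(\mathcal{BF}(X_\infty))=0$. If $p=2$, then $\mu_p(\mathcal{BF}(X_\infty))=0$ and \[ \lambda_p(\mathcal{BF}(X_\infty))=\begin{cases}0&\text{if }3\nmid n,\\ 2&\text{if }3\mid n.\end{cases} \] (2) Suppose that $n$ is even and $3\nmid n$. If $p\ne 3$, then $\mu_p(\mathcal{BF}(X_\infty))=\lambda_p(\mathcal{BF}(X_\infty))=0$. If $p=3$, then $\mu_p(\mathcal{BF}(X_\infty))=0$ and $\lambda_p(\mathcal{BF}(X_\infty))=1$.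
   Context: A digraph $X$ has a vertex set $V(X)$ and a set $E(X)$ of directed edges (loops and multiple edges allowed), each edge $e$ having an origin $o(e)$ and a terminus $t(e)$. For a group $G$ and a generating set $S$ of $G$, the (directed) Cayley graph $X(G,S)$ has vertex set $G$ and, for every $g\in G$ and $s\in S$, one directed edge from $g$ to $gs$. Constant tower: for a finite connected digraph $X$ and a prime $p$, let $\Gamma\simeq\mathbb{Z}_p$ (written multiplicatively) have topological generator $\theta$, and let $\theta_m$ be the image of $\theta$ in $\Gamma/\Gamma^{p^m}\simeq\mathbb{Z}/p^m\mathbb{Z}$. The layer $X_m$ has vertex set $V(X)\times\Gamma/\Gamma^{p^m}$, edge set $E(X)\times\Gamma/\Gamma^{p^m}$, and the edge $(e,g)$ goes from $(o(e),g)$ to $(t(e),g\theta_m)$. The number of connected components of $X_m$ stabilizes; let $m_0$ be the minimal index at which it does (then $X_{m_0}$ consists of $p^{m_0}$ copies of $X$). When the layers are not connected, the convention is to restrict to one component: fix a connected component $X'_{m_0}\cong X$ of $X_{m_0}$, and for $m\ge m_0$ let $X'_m$ be the unique connected component of $X_m$ above it; $X'_m/X'_{m_0}$ is Galois with group $\Gamma^{p^{m_0}}/\Gamma^{p^m}\simeq\mathbb{Z}/p^{m-m_0}\mathbb{Z}$. Let $\Gamma'=\Gamma^{p^{m_0}}\simeq\mathbb{Z}_p$ be the resulting Galois group (so $\Gamma'=\Gamma$ and $X'_m=X_m$ if all layers are connected). Bowen--Franks module: for a finite digraph $Y$, $\operatorname{Div}(Y)$ is the free abelian group on $V(Y)$,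 the adjacency operator $A_Y$ sends $v$ to $\sum_{e:\,o(e)=v}t(e)$, and $\mathcal{BF}(Y)=\operatorname{Div}(Y)/(\mathrm{Id}-A_Y)\operatorname{Div}(Y)$. Put $\mathcal{BF}(X_\infty)=\varprojlim_{m\ge m_0}\mathcal{BF}(X'_m)\otimes\mathbb{Z}_p$ (transition maps induced by the projections on vertices), a finitely generated module over $\Lambda=\mathbb{Z}_p\llbracket\Gamma'\rrbracket\simeq\mathbb{Z}_p\llbracket T\rrbracket$ (a topological generator of $\Gamma'$ mapping to $1+T$). Iwasawa invariants: a finitely generated torsion $\Lambda$-module $M$ is pseudo-isomorphic (finite kernel and cokernel) to $\bigoplus_{i}\Lambda/(p^{m_i})\oplus\bigoplus_j\Lambda/(f_j(T))$ with $m_i>0$ and $f_j$ distinguished polynomials (monic, non-leading coefficients divisible by $p$); then $\mu_p(M)=\sum_i m_i$ and $\lambda_p(M)=\sum_j\deg f_j$. *)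

(* Defs.v *)
From HB Require Import structures.
From mathcomp Require Import all_boot all_order all_fingroup all_algebra qpoly.
From mathcomp.multinomials Require Import freeg.
From mathcomp Require Import boolp cardinality.

Set Implicit Arguments.
Unset Strict Implicit.
Unset Printing Implicit Defensive.

Import GRing.Theory.
Local Open Scope ring_scope.

Section Span.
Variables (R : nzRingType) (V : lmodType R).

Inductive span (S : V -> Prop) : V -> Prop :=
| span_zero : span S 0
| span_lin a u v of S u & span S v : span S (a *: u + v).

Variable S : V -> Prop.

Lemma spanS u : S u -> span S u.
Proof.
by move=> Su; rewrite -[u]scale1r -[1 *: u]addr0; apply: span_lin (span_zero _).
Qed.

Lemma spanD u v : span S u -> span S v -> span S (u + v).
Proof.
move=> Su Sv; elim: Su => [|a x y Sx _ IH]; first by rewrite add0r.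
by rewrite -addrA; apply: span_lin.
Qed.

Lemma spanZ a u : span S u -> span S (a *: u).
Proof.
elim=> [|b x y Sx _ IH]; first by rewrite scaler0; apply: span_zero.
by rewrite scalerDr scalerA; apply: span_lin.
Qed.

Lemma spanN u : span S u -> span S (- u).
Proof. by rewrite -scaleN1r; apply: spanZ. Qed.

Definition span_pred : pred V := fun v => `[< span S v >].

Lemma span_zmod_closed : zmod_closed span_pred.
Proof.
split=> [|u v /asboolP Su /asboolP Sv]; apply/asboolP.
  exact: span_zero.
by apply: spanD => //; apply: spanN.
Qed.

Definition span_zmod : zmodClosed V :=
  HB.pack span_pred (GRing.isZmodClosed.Build V span_pred span_zmod_closed).

End Span.

Definition quotmod (R : nzRingType) (V : lmodType R) (S : V -> Prop) : Type :=
  Quotient.quot (span_zmod S).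

Section QuotMod.
Local Open Scope quotient_scope.
Variables (R : nzRingType) (V : lmodType R) (S : V -> Prop).

HB.instance Definition _ := GRing.Zmodule.on (quotmod S).

Definition qproj (v : V) : quotmod S := \pi_(Quotient.quot (span_zmod S)) v.
Definition qrepr (x : quotmod S) : V := generic_quotient.repr (x : Quotient.quot (span_zmod S)).

Lemma qreprK x : qproj (qrepr x) = x. Proof. exact: reprK. Qed.

Lemma qprojP u v : qproj u = qproj v <-> span S (u - v).
Proof.
have := Quotient.idealrBE (span_zmod S) u v.
rewrite /qproj => E; split=> [uv|Suv].
  by apply/asboolP; have /eqP := uv; rewrite -E.
by apply/eqP; rewrite -E; apply/asboolP.
Qed.

Lemma qprojD u v : qproj (u + v) = qproj u + qproj v.
Proof. exact: (raddfD (\pi_(Quotient.quot (span_zmod S)))). Qed.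

Definition qscale a x : quotmod S := qproj (a *: qrepr x).

Lemma qprojZ a u : qproj (a *: u) = qscale a (qproj u).
Proof.
apply/qprojP; rewrite -scalerBr; apply: spanZ.
by apply/qprojP; rewrite qreprK.
Qed.

Lemma qscaleA a b x : qscale a (qscale b x) = qscale (a * b) x.
Proof. by rewrite -[x]qreprK -!qprojZ scalerA. Qed.

Lemma qscale1 : left_id 1 qscale.
Proof. by move=> x; rewrite -[x]qreprK -!qprojZ scale1r. Qed.

Lemma qscaleDr : right_distributive qscale +%R.
Proof.
by move=> a x y; rewrite -[x]qreprK -[y]qreprK -qprojD -!qprojZ -qprojD scalerDr.
Qed.

Lemma qscaleDl x : {morph qscale^~ x : a b / a + b}.
Proof. by move=> a b; rewrite -[x]qreprK -!qprojZ -qprojD scalerDl. Qed.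

HB.instance Definition _ := GRing.Zmodule_isLmodule.Build R (quotmod S)
  qscaleA qscale1 qscaleDr qscaleDl.

Lemma qproj_is_linear : linear qproj.
Proof. by move=> a u v; rewrite qprojD qprojZ. Qed.

HB.instance Definition _ := GRing.isLinear.Build R V (quotmod S) _ qproj
  qproj_is_linear.

End QuotMod.

Definition mk_linear (R : nzRingType) (U V : lmodType R) (f : U -> V)
  (f_lin : linear f) : {linear U -> V} :=
  HB.pack f (GRing.isLinear.Build R U V *:%R f f_lin).

Section QuotMap.
Variables (R : nzRingType) (V W : lmodType R) (S : V -> Prop) (S' : W -> Prop).
Variable f : {linear V -> W}.
Hypothesis fS : forall v, S v -> span S' (f v).

Definition qmap_fun (x : quotmod S) : quotmod S' := qproj S' (f (qrepr x)).

Lemma qmapE v : qmap_fun (qproj S v) = qproj S' (f v).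
Proof.
apply/qprojP; rewrite -linearB.
have : span S (qrepr (qproj S v) - v) by apply/qprojP; rewrite qreprK.
elim=> [|a x y Sx _ IH]; first by rewrite linear0; apply: span_zero.
by rewrite linearP; apply: spanD IH; apply: spanZ; apply: fS.
Qed.

Lemma qmap_is_linear : linear qmap_fun.
Proof.
move=> a x y; rewrite -[x]qreprK -[y]qreprK -(linearP (qproj S)) !qmapE.
by rewrite (linearP f) (linearP (qproj S')).
Qed.

Definition qmap : {linear quotmod S -> quotmod S'} := mk_linear qmap_is_linear.

End QuotMap.

Lemma fglift_is_linear (R : nzRingType) (K : choiceType) (M : lmodType R)
  (f : K -> M) : linear (fglift f).
Proof.
have fD : {morph fglift f : D E / D + E}.
  move=> D E; have fB := lift_is_additive f.
  have f0 : fglift f 0 = 0 by rewrite -(subrr 0) fB subrr.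
  by rewrite -{1}[E]opprK -[- E]sub0r !fB f0 sub0r opprK.
move=> a D E; rewrite fD; congr (_ + _).
have f0 : fglift f 0 = 0 by apply: (addIr (fglift f 0)); rewrite -fD !add0r.
rewrite -[D]freeg_sumE.
rewrite [in RHS](big_morph _ fD f0) !scaler_sumr (big_morph _ fD f0).
apply: eq_bigr => x _; rewrite liftU scalerA -(liftU f).
congr (fglift f _); apply/eqP/freeg_eqP => y.
by rewrite coeffZ !coeffU mulrA.
Qed.

Definition fgext (R : nzRingType) (K : choiceType) (M : lmodType R)
  (f : K -> M) : {linear {freeg K / R} -> M} := mk_linear (fglift_is_linear f).

Lemma fgextU (R : nzRingType) (K : choiceType) (M : lmodType R)
  (f : K -> M) x : fgext f << x >> = f x.
Proof. by rewrite /fgext /= liftU scale1r. Qed.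

Lemma eq_fgext (R : nzRingType) (K : choiceType) (M : lmodType R)
  (f g : {linear {freeg K / R} -> M}) :
  (forall x, f << x >> = g << x >>) -> f =1 g.
Proof.
move=> fg D; rewrite -[D]freeg_sumE !linear_sum; apply: eq_bigr => x _.
suff -> : << coeff x D *g x >> = coeff x D *: << x >> :> {freeg K / R}.
  by rewrite !linearZ fg.
by apply/eqP/freeg_eqP => y; rewrite coeffZ !coeffU mulrA mulr1.
Qed.

Section Tensor.
Variable R : nzRingType.

Definition tensor_rel (A : zmodType) (D : {freeg A / R}) : Prop :=
  exists a b, D = << a + b >> - << a >> - << b >>.

(* The tensor product of A and R over the integers, as an R-module: the class
   of [<< r *g a >>] is the pure tensor of a and r.  R-linearity is built in by
   the choice of the free module, so additivity in A is the only relation. *)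
Definition tensor (A : zmodType) : lmodType R := quotmod (@tensor_rel A).

Definition pure_tensor (A : zmodType) (a : A) : tensor A := qproj _ << a >>.

Lemma pure_tensor_is_additive (A : zmodType) : zmod_morphism (@pure_tensor A).
Proof.
have pD x y : pure_tensor (x + y) = pure_tensor x + pure_tensor y :> tensor A.
  rewrite /pure_tensor -qprojD; apply/qprojP; rewrite opprD addrA.
  by apply: spanS; exists x, y.
by move=> x y; apply: (addIr (pure_tensor y)); rewrite -pD !subrK.
Qed.

HB.instance Definition _ (A : zmodType) :=
  GRing.isZmodMorphism.Build A (tensor A) (@pure_tensor A)
    (@pure_tensor_is_additive A).

Variables (A B : zmodType) (f : {additive A -> B}).

Definition fgmap_tensor : {linear {freeg A / R} -> {freeg B / R}} :=
  fgext (fun a => << f a >>).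

Lemma tensor_map_subproof D : tensor_rel D -> span (@tensor_rel B) (fgmap_tensor D).
Proof.
case=> a [b ->]; apply: spanS; exists (f a), (f b).
by rewrite /fgmap_tensor !linearB !fgextU raddfD.
Qed.

Definition tensor_map : {linear tensor A -> tensor B} := qmap tensor_map_subproof.

Lemma tensor_mapE a : tensor_map (pure_tensor a) = pure_tensor (f a).
Proof. by rewrite [LHS](qmapE tensor_map_subproof); congr qproj; apply: fgextU. Qed.

End Tensor.

Lemma eq_tensor (R : nzRingType) (A : zmodType) (M : lmodType R)
  (f g : {linear tensor R A -> M}) :
  (forall a, f (pure_tensor R a) = g (pure_tensor R a)) -> f =1 g.
Proof.
move=> fg x; rewrite -[x]qreprK.
have lin (h : {linear tensor R A -> M}) : linear (h \o qproj (@tensor_rel R A)).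
  by move=> a u v; rewrite /= !linearP.
by apply: (@eq_fgext _ _ _ (mk_linear (lin f)) (mk_linear (lin g))).
Qed.

Record ring_tower := RingTower {
  rt_ring :> nat -> comNzRingType;
  rt_map : forall k, {rmorphism rt_ring k.+1 -> rt_ring k} }.

Record ring_lim (T : ring_tower) := RingLim {
  rl_val :> forall k, T k;
  rl_compat : forall k, rt_map T k (rl_val k.+1) = rl_val k }.

Lemma ring_limP (T : ring_tower) (x y : ring_lim T) :
  (forall k, x k = y k) -> x = y.
Proof.
case: x y => [x xP] [y yP] /= xy.
have exy : x = y by apply: functional_extensionality_dep.
by case: _ / exy yP => yP; rewrite (Prop_irrelevance xP yP).
Qed.

HB.instance Definition _ (T : ring_tower) := gen_eqMixin (ring_lim T).
HB.instance Definition _ (T : ring_tower) := gen_choiceMixin (ring_lim T).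

Section RingLim.
Variable T : ring_tower.
Implicit Types x y z : ring_lim T.

Definition rl_zero : ring_lim T :=
  @RingLim T (fun k => 0) (fun k => rmorph0 _).
Lemma rl_opp_subproof x k : rt_map T k (- x k.+1) = - x k.
Proof. by rewrite rmorphN rl_compat. Qed.
Definition rl_opp x : ring_lim T := RingLim (rl_opp_subproof x).
Lemma rl_add_subproof x y k : rt_map T k (x k.+1 + y k.+1) = x k + y k.
Proof. by rewrite rmorphD !rl_compat. Qed.
Definition rl_add x y : ring_lim T := RingLim (rl_add_subproof x y).
Definition rl_one : ring_lim T :=
  @RingLim T (fun k => 1) (fun k => rmorph1 _).
Lemma rl_mul_subproof x y k : rt_map T k (x k.+1 * y k.+1) = x k * y k.
Proof. by rewrite rmorphM !rl_compat. Qed.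
Definition rl_mul x y : ring_lim T := RingLim (rl_mul_subproof x y).

Lemma rl_addA : associative rl_add.
Proof. by move=> x y z; apply: ring_limP => k; apply: addrA. Qed.
Lemma rl_addC : commutative rl_add.
Proof. by move=> x y; apply: ring_limP => k; apply: addrC. Qed.
Lemma rl_add0 : left_id rl_zero rl_add.
Proof. by move=> x; apply: ring_limP => k; apply: add0r. Qed.
Lemma rl_addN : left_inverse rl_zero rl_opp rl_add.
Proof. by move=> x; apply: ring_limP => k; apply: addNr. Qed.

HB.instance Definition _ := GRing.isZmodule.Build (ring_lim T)
  rl_addA rl_addC rl_add0 rl_addN.

Lemma rl_mulA : associative rl_mul.
Proof. by move=> x y z; apply: ring_limP => k; apply: mulrA. Qed.
Lemma rl_mulC : commutative rl_mul.
Proof. by move=> x y; apply: ring_limP => k; apply: mulrC. Qed.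
Lemma rl_mul1 : left_id rl_one rl_mul.
Proof. by move=> x; apply: ring_limP => k; apply: mul1r. Qed.
Lemma rl_mulDl : left_distributive rl_mul +%R.
Proof. by move=> x y z; apply: ring_limP => k; apply: mulrDl. Qed.
Lemma rl_one_neq0 : rl_one != 0.
Proof.
apply/eqP => /(congr1 (fun x : ring_lim T => x 0%N)) /= /eqP.
by rewrite oner_eq0.
Qed.

HB.instance Definition _ := GRing.Zmodule_isComNzRing.Build (ring_lim T)
  rl_mulA rl_mulC rl_mul1 rl_mulDl rl_one_neq0.

End RingLim.

Section Zp.
Variable p : nat.
Hypothesis p_pr : prime p.

(* The index is shifted by one because 'Z_1 is not the trivial ring. *)
Definition Zpow (k : nat) : comNzRingType := 'Z_(p ^ k.+1).

Lemma Zpow_gt1 k : (1 < p ^ k.+1)%N.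
Proof. by rewrite -[1%N](expn0 p) ltn_exp2l ?prime_gt1. Qed.

Definition Zpow_red k (x : Zpow k.+1) : Zpow k := (val x)%:R.

Lemma Zpow_natr k (a b : nat) : a = b %[mod (p ^ k.+1)%N] ->
  a%:R = b%:R :> Zpow k.
Proof.
move=> ab; apply: val_inj.
by rewrite /= !val_Zp_nat ?Zpow_gt1.
Qed.

Lemma Zpow_red_nat k (a : nat) : Zpow_red (a%:R : Zpow k.+1) = a%:R.
Proof.
apply: Zpow_natr; rewrite /= val_Zp_nat ?Zpow_gt1 // modn_dvdm //.
exact: dvdn_exp2l.
Qed.

Lemma Zpow_red_zmod k : zmod_morphism (@Zpow_red k).
Proof.
suff D : {morph (@Zpow_red k) : x y / x + y}.
  by move=> x y; apply: (addIr (Zpow_red y)); rewrite -D !subrK.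
move=> x y; rewrite -[x]natr_Zp -[y]natr_Zp -natrD !Zpow_red_nat.
by rewrite -natrD.
Qed.

Lemma Zpow_red_monoid k : monoid_morphism (@Zpow_red k).
Proof.
split=> [|x y]; first exact: (Zpow_red_nat k 1).
rewrite -[x]natr_Zp -[y]natr_Zp -natrM !Zpow_red_nat.
by rewrite -natrM.
Qed.

Definition Zpow_map k : {rmorphism Zpow k.+1 -> Zpow k} :=
  HB.pack (@Zpow_red k)
    (GRing.isZmodMorphism.Build _ _ (@Zpow_red k) (@Zpow_red_zmod k))
    (GRing.isMonoidMorphism.Build _ _ (@Zpow_red k) (@Zpow_red_monoid k)).

Definition Zp : comNzRingType := ring_lim (RingTower Zpow_map).

End Zp.

Section Iwasawa.
Variable p : nat.
Hypothesis p_pr : prime p.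
Variable R : comNzRingType.

Definition cyc_poly k : {poly R} := 'X^(p ^ k) - 1.

(* The group ring over R of the cyclic group of order p ^ k, the class of 'X
   being the distinguished generator. *)
Definition cyc_ring k : comNzRingType := {poly %/ cyc_poly k}.

Lemma size_cyc_poly k : size (cyc_poly k) = (p ^ k).+1.
Proof. by rewrite size_XnsubC // expn_gt0 prime_gt0. Qed.

Lemma monic_cyc_poly k : cyc_poly k \is monic.
Proof. by rewrite monicXnsubC // expn_gt0 prime_gt0. Qed.

Lemma mk_monic_cyc k : mk_monic (cyc_poly k) = cyc_poly k.
Proof.
by rewrite /mk_monic monic_cyc_poly size_cyc_poly ltnS expn_gt0 prime_gt0.
Qed.

Definition cyc_red k (x : cyc_ring k.+1) : cyc_ring k :=
  in_qpoly (cyc_poly k) (x : {poly R}).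

Lemma cyc_poly_dvd k :
  exists q, cyc_poly k.+1 = q * cyc_poly k.
Proof.
exists (\sum_(i < p) 'X^(p ^ k) ^+ i).
by rewrite mulrC -subrX1 -exprM -expnSr.
Qed.

Lemma in_qpoly_eq0 k (q : {poly R}) : in_qpoly (cyc_poly k) (q * cyc_poly k) = 0.
Proof.
have -> : in_qpoly (cyc_poly k) (q * cyc_poly k)
        = in_qpoly (cyc_poly k) q * in_qpoly (cyc_poly k) (cyc_poly k).
  exact: in_qpolyM.
suff -> : in_qpoly (cyc_poly k) (cyc_poly k) = 0 by rewrite mulr0.
by apply: val_inj; rewrite /= mk_monic_cyc; apply: Pdiv.RingMonic.rmodpp (monic_cyc_poly k).
Qed.

Lemma cyc_redE k (q : {poly R}) :
  cyc_red (in_qpoly (cyc_poly k.+1) q) = in_qpoly (cyc_poly k) q.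
Proof.
have mon := monic_cyc_poly k.+1.
rewrite {2}(Pdiv.RingMonic.rdivp_eq mon q) /cyc_red /= mk_monic_cyc.
have [c ->] := cyc_poly_dvd k.
by rewrite in_qpolyD mulrA in_qpoly_eq0 add0r.
Qed.

Lemma qpolyK k (x : cyc_ring k) : in_qpoly (cyc_poly k) (x : {poly R}) = x.
Proof. by apply: val_inj; apply: in_qpoly_small; apply: size_mk_monic. Qed.

Lemma cyc_red_zmod k : zmod_morphism (@cyc_red k).
Proof.
move=> x y; rewrite -[x]qpolyK -[y]qpolyK.
by rewrite -raddfB !cyc_redE raddfB.
Qed.

Lemma cyc_red_monoid k : monoid_morphism (@cyc_red k).
Proof.
split=> [|x y]; first by rewrite -(rmorph1 (in_qpoly _)) cyc_redE rmorph1.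
rewrite -[x]qpolyK -[y]qpolyK.
by rewrite -rmorphM !cyc_redE rmorphM.
Qed.

Definition cyc_map k : {rmorphism cyc_ring k.+1 -> cyc_ring k} :=
  HB.pack (@cyc_red k)
    (GRing.isZmodMorphism.Build _ _ (@cyc_red k) (@cyc_red_zmod k))
    (GRing.isMonoidMorphism.Build _ _ (@cyc_red k) (@cyc_red_monoid k)).

(* R[[Gamma']] as the limit of the group rings of the finite quotients of
   Gamma'; for R = Zp it is the power series ring Zp[[T]], T being [iw_T]. *)
Definition iwasawa_tower : ring_tower := RingTower cyc_map.
Definition iwasawa : comNzRingType := ring_lim iwasawa_tower.

Lemma iw_poly_subproof (q : {poly R}) k :
  rt_map iwasawa_tower k (in_qpoly (cyc_poly k.+1) q) = in_qpoly (cyc_poly k) q.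
Proof. exact: cyc_redE. Qed.

Definition iw_poly (q : {poly R}) : iwasawa := RingLim (iw_poly_subproof q).
Definition iw_const (c : R) : iwasawa := iw_poly c%:P.
Definition iw_gen : iwasawa := iw_poly 'X.

(* T = gamma - 1, and the value f(T) of a polynomial f with coefficients in R. *)
Definition iw_T : iwasawa := iw_gen - 1.
Definition iw_eval (f : {poly R}) : iwasawa := (map_poly iw_const f).[iw_T].

End Iwasawa.

Section ModLim.
Variable p : nat.
Hypothesis p_pr : prime p.
Variable R : comNzRingType.

(* A compatible system of modules over the group rings [cyc_ring p R k]: the
   k-th module carries an endomorphism whose p ^ k-th iterate is the identity.
   Its limit is a module over [iwasawa p_pr R], acting componentwise. *)
Record mod_tower := ModTower {
  mt_mod :> nat -> lmodType R;
  mt_map : forall k, {linear mt_mod k.+1 -> mt_mod k};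
  mt_gen : forall k, {linear mt_mod k -> mt_mod k};
  mt_genX : forall k x, iter (p ^ k) (mt_gen k) x = x;
  mt_map_gen : forall k x, mt_map k (mt_gen k.+1 x) = mt_gen k (mt_map k x) }.

Record mod_lim (M : mod_tower) := ModLim {
  ml_val :> forall k, M k;
  ml_compat : forall k, mt_map M k (ml_val k.+1) = ml_val k }.

Lemma mod_limP (M : mod_tower) (x y : mod_lim M) :
  (forall k, x k = y k) -> x = y.
Proof.
case: x y => [x xP] [y yP] /= xy.
have exy : x = y by apply: functional_extensionality_dep.
by case: _ / exy yP => yP; rewrite (Prop_irrelevance xP yP).
Qed.

HB.instance Definition _ (M : mod_tower) := gen_eqMixin (mod_lim M).
HB.instance Definition _ (M : mod_tower) := gen_choiceMixin (mod_lim M).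

Section Action.
Variables (V : lmodType R) (g : {linear V -> V}).

Lemma iter_is_linear j : linear (iter j g).
Proof. by move=> a u v; elim: j => //= j ->; rewrite linearP. Qed.

Definition poly_act (q : {poly R}) (v : V) : V :=
  \sum_(i < size q) q`_i *: iter i g v.

Lemma poly_act_widen n (q : {poly R}) v : (size q <= n)%N ->
  poly_act q v = \sum_(i < n) q`_i *: iter i g v.
Proof.
move=> le_qn; rewrite /poly_act (big_ord_widen n (fun i => q`_i *: iter i g v)) //.
rewrite big_mkcond; apply: eq_bigr => i _; case: ltnP => // le_qi.
by rewrite nth_default // scale0r.
Qed.

Lemma poly_actD q r v : poly_act (q + r) v = poly_act q v + poly_act r v.
Proof.
pose n := maxn (size q) (size r).
rewrite !(@poly_act_widen n) ?leq_maxl ?leq_maxr ?size_polyD //.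
by rewrite -big_split; apply: eq_bigr => i _; rewrite coefD scalerDl.
Qed.

Lemma poly_act0 v : poly_act 0 v = 0.
Proof. by rewrite /poly_act size_poly0 big_ord0. Qed.

Lemma poly_actC c v : poly_act c%:P v = c *: v.
Proof.
by rewrite (@poly_act_widen 1) ?size_polyC_leq1 // big_ord1 coefC eqxx.
Qed.

Lemma poly_act_is_linear q : linear (poly_act q).
Proof.
move=> a u v; rewrite /poly_act scaler_sumr -big_split; apply: eq_bigr => i _.
by rewrite iter_is_linear scalerDr !scalerA mulrC.
Qed.

HB.instance Definition _ q := GRing.isLinear.Build R V V *:%R (poly_act q)
  (poly_act_is_linear q).

Lemma poly_actMX q v : poly_act (q * 'X) v = poly_act q (g v).
Proof.
rewrite (@poly_act_widen (size q).+1); last first.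
  by rewrite (leq_trans (size_polyMleq _ _)) // size_polyX addn2.
rewrite big_ord_recl coefMX /= scale0r add0r; apply: eq_bigr => i _.
by rewrite coefMX /= -iterSr.
Qed.

Lemma poly_actM q r v : poly_act (q * r) v = poly_act q (poly_act r v).
Proof.
elim/poly_ind: r q v => [|r c IH] q v.
  by rewrite mulr0 !poly_act0 linear0.
rewrite mulrDr poly_actD mulrA poly_actMX IH poly_actD linearD; congr (_ + _).
  by rewrite poly_actMX.
rewrite poly_actC mulrC mul_polyC linearZ /= /poly_act.
rewrite scaler_sumr -(big_mkord predT (fun i => (c *: q)`_i *: iter i g v)).
rewrite big_mkord -/(poly_act _ _) (@poly_act_widen (size q)) ?size_scale_leq //.
by apply: eq_bigr => i _; rewrite coefZ scalerA.
Qed.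

Lemma poly_actXn n v : poly_act 'X^n v = iter n g v.
Proof.
elim: n v => [|n IH] v; first by rewrite expr0 poly_actC scale1r.
by rewrite exprSr poly_actMX IH -iterSr.
Qed.

Lemma poly_act_mod k q v : (forall x, iter (p ^ k) g x = x) ->
  poly_act (in_qpoly (cyc_poly p R k) q : {poly R}) v = poly_act q v.
Proof.
move=> gX; have mon := monic_cyc_poly p_pr R k.
rewrite {2}(Pdiv.RingMonic.rdivp_eq mon q) /= mk_monic_cyc // poly_actD.
rewrite poly_actM /cyc_poly poly_actD poly_actXn gX -polyCN poly_actC.
by rewrite scaleN1r subrr linear0 add0r.
Qed.

End Action.

Variable M : mod_tower.
Local Notation L := (iwasawa p_pr R).
Implicit Types x y z : mod_lim M.

Definition ml_zero : mod_lim M :=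
  @ModLim M (fun k => 0) (fun k => linear0 _).
Lemma ml_opp_subproof x k : mt_map M k (- x k.+1) = - x k.
Proof. by rewrite linearN ml_compat. Qed.
Definition ml_opp x : mod_lim M := ModLim (ml_opp_subproof x).
Lemma ml_add_subproof x y k : mt_map M k (x k.+1 + y k.+1) = x k + y k.
Proof. by rewrite linearD !ml_compat. Qed.
Definition ml_add x y : mod_lim M := ModLim (ml_add_subproof x y).

Lemma ml_addA : associative ml_add.
Proof. by move=> x y z; apply: mod_limP => k; apply: addrA. Qed.
Lemma ml_addC : commutative ml_add.
Proof. by move=> x y; apply: mod_limP => k; apply: addrC. Qed.
Lemma ml_add0 : left_id ml_zero ml_add.
Proof. by move=> x; apply: mod_limP => k; apply: add0r. Qed.
Lemma ml_addN : left_inverse ml_zero ml_opp ml_add.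
Proof. by move=> x; apply: mod_limP => k; apply: addNr. Qed.

HB.instance Definition _ := GRing.isZmodule.Build (mod_lim M)
  ml_addA ml_addC ml_add0 ml_addN.

Lemma mt_map_act k (q : {poly R}) (v : M k.+1) :
  mt_map M k (poly_act (mt_gen M k.+1) q v)
  = poly_act (mt_gen M k) q (mt_map M k v).
Proof.
rewrite /poly_act linear_sum; apply: eq_bigr => i _; rewrite linearZ /=.
congr (_ *: _); elim: (nat_of_ord i) => //= j <-; exact: mt_map_gen.
Qed.

Lemma ml_scale_subproof (a : L) x k :
  mt_map M k (poly_act (mt_gen M k.+1) (a k.+1 : {poly R}) (x k.+1))
  = poly_act (mt_gen M k) (a k : {poly R}) (x k).
Proof.
rewrite mt_map_act ml_compat -(rl_compat a k).
by rewrite [RHS]poly_act_mod //; apply: mt_genX.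
Qed.
Definition ml_scale (a : L) x : mod_lim M := ModLim (ml_scale_subproof a x).

Lemma ml_scaleA a b x : ml_scale a (ml_scale b x) = ml_scale (a * b) x.
Proof.
apply: mod_limP => k /=; rewrite -poly_actM.
by rewrite -[LHS](@poly_act_mod _ _ k) //; apply: mt_genX.
Qed.
Lemma ml_scale1 : left_id 1 ml_scale.
Proof.
by move=> x; apply: mod_limP => k /=; rewrite poly_actC scale1r.
Qed.
Lemma ml_scaleDr : right_distributive ml_scale +%R.
Proof. by move=> a x y; apply: mod_limP => k; apply: linearD. Qed.
Lemma ml_scaleDl x : {morph ml_scale^~ x : a b / a + b}.
Proof. by move=> a b; apply: mod_limP => k; apply: poly_actD. Qed.

HB.instance Definition _ := GRing.Zmodule_isLmodule.Build L (mod_lim M)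
  ml_scaleA ml_scale1 ml_scaleDr ml_scaleDl.

End ModLim.

Record digraph := Digraph {
  vertex : finType;
  edge : finType;
  origin : edge -> vertex;
  terminus : edge -> vertex }.

(* Adjacency in the underlying undirected graph: connected components are taken
   regardless of the direction of the edges. *)
Definition adjacent (X : digraph) (u v : vertex X) : bool :=
  [exists e : edge X, ((origin e == u) && (terminus e == v))
                   || ((origin e == v) && (terminus e == u))].

Lemma adjacent_sym (X : digraph) : symmetric (@adjacent X).
Proof. by move=> u v; apply/eq_existsb => e; rewrite orbC. Qed.

Definition n_components (X : digraph) : nat :=
  n_comp (@adjacent X) (predT : pred (vertex X)).

Definition component (X : digraph) (v : vertex X) : {set vertex X} :=
  [set w | connect (@adjacent X) v w].

Lemma component_closed (X : digraph) (v : vertex X) (e : edge X) :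
  (origin e \in component v) = (terminus e \in component v).
Proof.
rewrite !inE; apply: same_connect_r; first exact/sym_connect_sym/adjacent_sym.
by apply: connect1; apply/existsP; exists e; rewrite !eqxx.
Qed.

Definition induced (X : digraph) (C : {set vertex X}) : digraph :=
  @Digraph {v : vertex X | v \in C}
    {e : edge X | (origin e \in C) && (terminus e \in C)}
    (fun e => Sub (origin (val e)) (proj1 (andP (valP e))))
    (fun e => Sub (terminus (val e)) (proj2 (andP (valP e)))).

Definition cayley (gT : finGroupType) (S : {set gT}) : digraph :=
  @Digraph gT (gT * {s : gT | s \in S})%type
    (fun e => e.1) (fun e => (e.1 * val e.2)%g).

(* The relations make the group generated by s and t a quotient of D_2n, and the
   cardinality makes it D_2n itself; this includes the degenerate n = 1, 2. *)
Definition dihedral_generators (n : nat) (gT : finGroupType) (s t : gT) : Prop :=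
  [/\ #|gT| = (2 * n)%N, generated [set s; t] = [set: gT],
      (s ^+ n = 1)%g, (t ^+ 2 = 1)%g & (t * s * t = s^-1)%g].

Section BowenFranks.
Variable Y : digraph.

Definition Div : lmodType int := {freeg (vertex Y) / int}.

Definition adjop : {linear Div -> Div} :=
  fgext (fun v => \sum_(e : edge Y | origin e == v) << terminus e >> : Div).

Definition BF : lmodType int :=
  quotmod (fun D : Div => exists D', D = D' - adjop D').

End BowenFranks.

Arguments adjop {Y}.

Section Pushforward.
Variables (Y Z : digraph) (f : vertex Y -> vertex Z) (h : edge Y -> edge Z).

Definition pushforward : {linear Div Y -> Div Z} :=
  fgext (fun v => << f v >> : Div Z).

(* Coverings of digraphs: h restricts to a bijection from the edges leaving v
   to the edges leaving f v. *)
Record covering : Prop := Covering {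
  cov_orig : forall e, origin (h e) = f (origin e);
  cov_term : forall e, terminus (h e) = f (terminus e);
  cov_inj : forall v, {in [pred e | origin e == v] &, injective h};
  cov_surj : forall v e', origin e' = f v -> exists2 e, origin e = v & h e = e' }.

Hypothesis cov : covering.

Lemma push_adjop D : pushforward (adjop D) = adjop (pushforward D).
Proof.
pose l : {linear Div Y -> Div Z} := pushforward \o @adjop Y.
pose r : {linear Div Y -> Div Z} := @adjop Z \o pushforward.
rewrite -[LHS]/(l D) -[RHS]/(r D); apply: eq_fgext => v.
change (pushforward (adjop << v >>) = adjop (pushforward << v >>)).
rewrite [adjop << v >>]fgextU [pushforward << v >>]fgextU [RHS]fgextU linear_sum.
transitivity (\sum_(e' in h @: [set e | origin e == v]) << terminus e' >> : Div Z).
  rewrite big_imset; last first.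
    by move=> e1 e2; rewrite !inE => ? ?; apply: (cov_inj cov (v := v)).
  by apply: eq_big => [e|e _]; rewrite ?inE // [LHS]fgextU cov_term.
apply: eq_bigl => e'; apply/imsetP/eqP => [[e]|].
  by rewrite inE => /eqP <- ->; apply: cov_orig.
by move=> /(cov_surj cov)[e ev <-]; exists e; rewrite ?inE ?ev.
Qed.

Lemma BF_map_subproof D : (exists D', D = D' - adjop D') ->
  span (fun D : Div Z => exists D', D = D' - adjop D') (pushforward D).
Proof.
case=> D' ->; apply: spanS; exists (pushforward D').
by rewrite linearB push_adjop.
Qed.

Definition BF_map : {linear BF Y -> BF Z} := qmap BF_map_subproof.

Lemma BF_mapE v : BF_map (qproj _ << v >>) = qproj _ << f v >>.
Proof. by rewrite [LHS](qmapE BF_map_subproof) [pushforward _]fgextU. Qed.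

End Pushforward.

Lemma BF_map_eq (Y : digraph) (M : zmodType) (f g : {additive BF Y -> M}) :
  (forall v, f (qproj _ << v >>) = g (qproj _ << v >>)) -> f =1 g.
Proof.
move=> fg x; rewrite -[x]qreprK -[qrepr x]freeg_sumE.
rewrite !(linear_sum (qproj _)) !raddf_sum; apply: eq_bigr => v _.
have -> : << coeff v (qrepr x) *g v >> = coeff v (qrepr x) *: << v >> :> Div Y.
  by apply/eqP/freeg_eqP => y; rewrite coeffZ !coeffU mulrA mulr1.
rewrite linearZ /= -[coeff _ _]intz scaler_int !raddfMz.
by rewrite fg.
Qed.

Section Tower.
Variable p : nat.
Hypothesis p_pr : prime p.
Variable X : digraph.

(* The quotient of Gamma by its p ^ m-th powers is identified with 'I_(p ^ m),
   the class of theta ^ i being i; multiplication by theta is [ordS]. *)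
Definition layer (m : nat) : digraph :=
  @Digraph (vertex X * 'I_(p ^ m))%type (edge X * 'I_(p ^ m))%type
    (fun e => (origin e.1, e.2)) (fun e => (terminus e.1, ordS e.2)).

Definition stabilizes_from (m : nat) : Prop :=
  forall k, (m <= k)%N -> n_components (layer k) = n_components (layer m).

Definition stabilization_index (m0 : nat) : Prop :=
  stabilizes_from m0 /\ forall m, stabilizes_from m -> (m0 <= m)%N.

Lemma ppow_gt0 m : (0 < p ^ m)%N.
Proof. by rewrite expn_gt0 prime_gt0. Qed.

Definition ord_red a b (i : 'I_(p ^ b)) : 'I_(p ^ a) :=
  Ordinal (ltn_pmod i (ppow_gt0 a)).

Definition layer_proj a b (v : vertex (layer b)) : vertex (layer a) :=
  (v.1, ord_red a v.2).
Definition layer_eproj a b (e : edge (layer b)) : edge (layer a) :=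
  (e.1, ord_red a e.2).

Lemma ord_red_ordS a b (i : 'I_(p ^ b)) : (a <= b)%N ->
  ord_red a (ordS i) = ordS (ord_red a i).
Proof.
move=> ab; apply: val_inj => /=.
by rewrite modn_dvdm ?dvdn_exp2l // -addn1 -[in RHS]addn1 modnDml.
Qed.

Lemma ord_red_red a b c (i : 'I_(p ^ c)) : (a <= b)%N ->
  ord_red a (ord_red b i) = ord_red a i.
Proof. by move=> ab; apply: val_inj; rewrite /= modn_dvdm // dvdn_exp2l. Qed.

Lemma ord_red_id a (i : 'I_(p ^ a)) : ord_red a i = i.
Proof. by apply: val_inj; rewrite /= modn_small. Qed.

Variables (m0 : nat) (x0 : vertex (layer m0)).

Definition above k : {set vertex (layer (m0 + k))} :=
  [set v | layer_proj m0 v \in component x0].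

(* With X'_(m0) the component of x0, this is the part of the layer m0 + k lying
   above it, which is a connected component by [above_component]. *)
Definition clayer k : digraph := induced (above k).

Lemma above_closed k (e : edge (layer (m0 + k))) :
  (origin e \in above k) = (terminus e \in above k).
Proof.
rewrite !inE -[RHS]/(connect _ _ (_, ord_red m0 (ordS e.2))).
rewrite ord_red_ordS ?leq_addr //.
by have := component_closed x0 (layer_eproj m0 e); rewrite !inE.
Qed.

Lemma layer_proj_connect a b (v w : vertex (layer b)) : (a <= b)%N ->
  connect (@adjacent (layer b)) v w ->
  connect (@adjacent (layer a)) (layer_proj a v) (layer_proj a w).
Proof.
move=> ab /connectP[q vq ->]; elim: q v vq => [|u q IH] v //= /andP[vu uq].
apply: connect_trans (IH u uq); apply: connect1.
have [e eP] := existsP vu; apply/existsP; exists (layer_eproj a e).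
have te : terminus (layer_eproj a e) = layer_proj a (terminus e).
  by rewrite /layer_proj /= ord_red_ordS.
rewrite te -[origin (layer_eproj a e)]/(layer_proj a (origin e)).
by case/orP: eP => /andP[/eqP -> /eqP ->]; rewrite !eqxx ?orbT.
Qed.

Lemma above_component k (w : vertex (layer (m0 + k))) :
  stabilizes_from m0 -> w \in above k -> above k = component w.
Proof.
have le_mk : (m0 <= m0 + k)%N := leq_addr k m0.
pose a := @adjacent (layer m0); pose b := @adjacent (layer (m0 + k)).
have sa : connect_sym a := sym_connect_sym (@adjacent_sym _).
have sb : connect_sym b := sym_connect_sym (@adjacent_sym _).
pose phi (v : vertex (layer (m0 + k))) := fingraph.root a (layer_proj m0 v).
have phiP v v' : connect b v v' -> phi v = phi v'.
  by move=> vv'; apply/(fingraph.rootP sa)/layer_proj_connect.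
have cardE (Y : digraph) : n_components Y = #|roots (@adjacent Y)|.
  by apply: eq_card => v; rewrite !inE andbT.
move=> /(_ _ le_mk); rewrite !cardE -/a -/b => Ecard.
have phi_inj : {in roots b &, injective phi}.
  apply/image_injP; rewrite eqn_leq leq_image_card Ecard.
  apply/subset_leq_card/subsetP => s /eqP sP; apply/imageP.
  have lt_s : (s.2 < p ^ (m0 + k))%N.
    by apply: leq_trans (ltn_ord _) _; rewrite leq_exp2l ?prime_gt1.
  pose v : vertex (layer (m0 + k)) := (s.1, Ordinal lt_s).
  exists (fingraph.root b v); first exact: roots_root.
  rewrite -(phiP v) ?connect_root // /phi -[LHS]sP; congr (fingraph.root a _).
  by rewrite [LHS]surjective_pairing; congr pair; apply: val_inj; rewrite /= modn_small.
rewrite !inE => xw; apply/setP => v; rewrite !inE.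
apply/idP/idP => [xv|wv]; last exact: connect_trans xw (layer_proj_connect _ wv).
apply/(fingraph.rootP sb)/phi_inj; try exact: roots_root.
have P u : phi (fingraph.root b u) = phi u by rewrite -(phiP _ _ (connect_root b u)).
rewrite [LHS]P [RHS]P; apply/(fingraph.rootP sa).
by apply: connect_trans xv; rewrite sa.
Qed.

Lemma clayer_proj_subproof k (v : vertex (clayer k.+1)) :
  layer_proj (m0 + k) (val v) \in above k.
Proof.
have := valP v; rewrite !inE /layer_proj /= ord_red_red ?leq_addr //.
Qed.

Definition clayer_proj k (v : vertex (clayer k.+1)) : vertex (clayer k) :=
  Sub (layer_proj (m0 + k) (val v)) (clayer_proj_subproof v).

Lemma clayer_eproj_subproof k (e : edge (clayer k.+1)) :
  (origin (layer_eproj (m0 + k) (val e)) \in above k)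
  && (terminus (layer_eproj (m0 + k) (val e)) \in above k).
Proof. 
rewrite -above_closed andbb; exact: (clayer_proj_subproof (origin e)).
Qed.

Definition clayer_eproj k (e : edge (clayer k.+1)) : edge (clayer k) :=
  Sub (layer_eproj (m0 + k) (val e)) (clayer_eproj_subproof e).

Lemma clayer_proj_covering k : covering (@clayer_proj k) (@clayer_eproj k).
Proof.
split=> [e|e|v|v e'].
- by apply: val_inj.
- by apply: val_inj; rewrite /= /layer_proj /= ord_red_ordS // leq_add2l.
- move=> e1 e2 /eqP o1 /eqP o2 /(congr1 val) /= [e12 _].
  apply: val_inj; rewrite [val e1]surjective_pairing e12.
  have : origin e1 = origin e2 by rewrite o1 o2.
  by move=> /(congr1 val) /= [_ ->]; rewrite -surjective_pairing.
move=> /(congr1 val) /= [o' r'].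
pose e : edge (layer (m0 + k.+1)) := ((val e').1, (val v).2).
have oe : origin e = val v by rewrite /= o' -surjective_pairing.
have eP : (origin e \in above k.+1) && (terminus e \in above k.+1).
  by rewrite -above_closed andbb oe (valP v).
exists (Sub e eP); apply: val_inj => //=.
by rewrite /layer_eproj /= -r' -surjective_pairing.
Qed.

(* The generator theta ^ (p ^ m0) of Gamma' acts by deck transformations. *)
Definition deck k (v : vertex (layer (m0 + k))) : vertex (layer (m0 + k)) :=
  (v.1, iter (p ^ m0) (@ordS _) v.2).
Definition edeck k (e : edge (layer (m0 + k))) : edge (layer (m0 + k)) :=
  (e.1, iter (p ^ m0) (@ordS _) e.2).

Lemma val_iter_ordS n j (i : 'I_n) : iter j (@ordS n) i = ((i + j) %% n)%N :> nat.
Proof.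
elim: j => [|j IH]; first by rewrite addn0 modn_small.
by rewrite iterS /= IH -addn1 modnDml addn1 addnS.
Qed.

Lemma iter_ordS_period n (i : 'I_n) : iter n (@ordS n) i = i.
Proof. by apply: val_inj; rewrite /= val_iter_ordS modnDr modn_small. Qed.

Lemma ord_red_iter a b j (i : 'I_(p ^ b)) : (a <= b)%N ->
  ord_red a (iter j (@ordS _) i) = iter j (@ordS _) (ord_red a i).
Proof. by move=> ab; elim: j => //= j <-; rewrite ord_red_ordS. Qed.

Lemma deck_above k (v : vertex (layer (m0 + k))) :
  (deck v \in above k) = (v \in above k).
Proof.
rewrite !inE /layer_proj /= ord_red_iter ?leq_addr //.
by rewrite iter_ordS_period.
Qed.

Lemma cdeck_subproof k (v : vertex (clayer k)) : deck (val v) \in above k.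
Proof. by rewrite deck_above (valP v). Qed.

Definition cdeck k (v : vertex (clayer k)) : vertex (clayer k) :=
  Sub (deck (val v)) (cdeck_subproof v).

Lemma cedeck_subproof k (e : edge (clayer k)) :
  (origin (edeck (val e)) \in above k) && (terminus (edeck (val e)) \in above k).
Proof. by rewrite -above_closed andbb; exact: (cdeck_subproof (origin e)). Qed.

Definition cedeck k (e : edge (clayer k)) : edge (clayer k) :=
  Sub (edeck (val e)) (cedeck_subproof e).

Lemma cdeck_covering k : covering (@cdeck k) (@cedeck k).
Proof.
split=> [e|e|v|v e'].
- by apply: val_inj.
- by apply: val_inj; rewrite /= /deck /= -iterS iterSr.
- move=> e1 e2 /eqP o1 /eqP o2 /(congr1 val) /= [e12 _].
  apply: val_inj; rewrite [val e1]surjective_pairing e12.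
  have : origin e1 = origin e2 by rewrite o1 o2.
  by move=> /(congr1 val) /= [_ ->]; rewrite -surjective_pairing.
move=> /(congr1 val) /= [o' r'].
pose e : edge (layer (m0 + k)) := ((val e').1, (val v).2).
have oe : origin e = val v by rewrite /= o' -surjective_pairing.
have eP : (origin e \in above k) && (terminus e \in above k).
  by rewrite -above_closed andbb oe (valP v).
exists (Sub e eP); apply: val_inj => //=.
by rewrite /edeck /= -r' -surjective_pairing.
Qed.

Lemma cdeck_period k (v : vertex (clayer k)) : iter (p ^ k) (@cdeck k) v = v.
Proof.
apply: val_inj; rewrite [RHS]surjective_pairing.
suff E j : val (iter j (@cdeck k) v)
         = ((val v).1, iter (j * p ^ m0) (@ordS _) (val v).2).
  by rewrite E (_ : (p ^ k * p ^ m0)%N = (p ^ (m0 + k))%N) ?iter_ordS_period // -expnD addnC.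
elim: j => [|j IH]; first by rewrite [LHS]surjective_pairing.
by rewrite iterS /= IH /deck /= -iterD.
Qed.

Lemma cdeck_proj k (v : vertex (clayer k.+1)) :
  clayer_proj (cdeck v) = cdeck (clayer_proj v).
Proof.
by apply: val_inj; rewrite /= /layer_proj /deck /= ord_red_iter // leq_add2l.
Qed.

Definition BFZp k : lmodType (Zp p_pr) := tensor (Zp p_pr) (BF (clayer k)).

Definition BFZp_proj k : {linear BFZp k.+1 -> BFZp k} :=
  tensor_map (Zp p_pr) (BF_map (@clayer_proj_covering k)).

Definition BFZp_gen k : {linear BFZp k -> BFZp k} :=
  tensor_map (Zp p_pr) (BF_map (@cdeck_covering k)).

Definition BFZp_pure k (v : vertex (clayer k)) : BFZp k :=
  pure_tensor (Zp p_pr) (qproj _ << v >> : BF (clayer k)).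

Lemma BFZp_gen_pure k (v : vertex (clayer k)) :
  BFZp_gen k (BFZp_pure v) = BFZp_pure (cdeck v).
Proof. by rewrite /BFZp_pure -(BF_mapE (@cdeck_covering k)); apply: tensor_mapE. Qed.

Lemma BFZp_proj_pure k (v : vertex (clayer k.+1)) :
  BFZp_proj k (BFZp_pure v) = BFZp_pure (clayer_proj v).
Proof.
by rewrite /BFZp_pure -(BF_mapE (@clayer_proj_covering k)); apply: tensor_mapE.
Qed.

Lemma eq_BFZp k (M : lmodType (Zp p_pr)) (f g : {linear BFZp k -> M}) :
  (forall v, f (BFZp_pure v) = g (BFZp_pure v)) -> f =1 g.
Proof.
move=> fg; apply: eq_tensor.
pose f' : {additive BF (clayer k) -> M} := f \o @pure_tensor (Zp p_pr) (BF (clayer k)).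
pose g' : {additive BF (clayer k) -> M} := g \o @pure_tensor (Zp p_pr) (BF (clayer k)).
exact: (@BF_map_eq _ _ f' g').
Qed.

Lemma BFZp_genX k (x : BFZp k) : iter (p ^ k) (BFZp_gen k) x = x.
Proof.
pose f := mk_linear (iter_is_linear (BFZp_gen k) (p ^ k)%N).
apply: (@eq_BFZp _ _ f idfun) => v.
suff E j : iter j (BFZp_gen k) (BFZp_pure v) = BFZp_pure (iter j (@cdeck k) v).
  by rewrite [LHS]E cdeck_period.
by elim: j => [|j IH] //; rewrite !iterS IH BFZp_gen_pure.
Qed.

Lemma BFZp_proj_gen k (x : BFZp k.+1) :
  BFZp_proj k (BFZp_gen k.+1 x) = BFZp_gen k (BFZp_proj k x).
Proof.
pose f : {linear BFZp k.+1 -> BFZp k} := BFZp_proj k \o BFZp_gen k.+1.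
pose g : {linear BFZp k.+1 -> BFZp k} := BFZp_gen k \o BFZp_proj k.
apply: (@eq_BFZp _ _ f g) => v.
transitivity (BFZp_proj k (BFZp_pure (cdeck v))).
  by congr (BFZp_proj k _); apply: BFZp_gen_pure.
transitivity (BFZp_gen k (BFZp_pure (clayer_proj v))).
  by rewrite BFZp_proj_pure BFZp_gen_pure cdeck_proj.
by congr (BFZp_gen k _); rewrite -BFZp_proj_pure.
Qed.

Definition BF_tower : mod_tower p (Zp p_pr) := ModTower BFZp_genX BFZp_proj_gen.

Definition BF_infty : lmodType (iwasawa p_pr (Zp p_pr)) := mod_lim BF_tower.

End Tower.

Section Invariants.
Variable p : nat.
Hypothesis p_pr : prime p.
Local Notation L := (iwasawa p_pr (Zp p_pr)).

Definition distinguished (f : {poly (Zp p_pr)}) : Prop :=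
  f \is monic /\ forall i, (i < (size f).-1)%N -> exists c, f`_i = p%:R * c.

Definition cyclic_module (g : L) : lmodType L :=
  quotmod (fun x : L^o => x = g).

Definition elementary_module (gs : seq L) : lmodType L :=
  foldr (fun g (E : lmodType L) => (cyclic_module g * E)%type : lmodType L)
    ('rV[L]_0 : lmodType L) gs.

Definition pseudo_isomorphism (M N : lmodType L) (phi : {linear M -> N}) : Prop :=
  finite_set (fun x : M => phi x = 0)
  /\ finite_set (fun _ : quotmod (fun y : N => exists x, y = phi x) => True).

(* [iwasawa_invariants M mu lambda] means that M is a finitely generated torsion
   module with these invariants: a module pseudo-isomorphic to an elementary one
   is finitely generated and torsion, and mu and lambda are then unique. *)
Definition iwasawa_invariants (M : lmodType L) (mu lambda : nat) : Prop :=
  exists (ms : seq nat) (fs : seq {poly (Zp p_pr)}),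
    [/\ all (leq 1) ms, (forall f, f \in fs -> distinguished f),
        mu = (\sum_(m <- ms) m)%N, lambda = (\sum_(f <- fs) (size f).-1)%N &
        exists phi : {linear M -> elementary_module
            ([seq p%:R ^+ m | m <- ms] ++ [seq iw_eval p_pr f | f <- fs])},
          pseudo_isomorphism phi].

End Invariants.

(* Main.v *)
Require Import Defs.
From HB Require Import structures.
From mathcomp Require Import all_boot all_order all_fingroup all_algebra.
From mathcomp Require Import qpoly cyclic ring.
From mathcomp.multinomials Require Import freeg.
From mathcomp Require Import boolp cardinality classical_sets.

(** Write [g, i] for the class of the vertex (g, theta^i) in the Bowen-Franks
   module of a layer.  The defining relations are

     [g, i] = [g sigma, i+1] + [g tau, i+1].

   Their right-hand side does not change when g is replaced by g sigma tau,
   because g sigma tau sigma = g tau and g sigma tau tau = g sigma.  Hence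
   [g sigma tau, i] = [g, i], that is [g tau, i] = [g sigma^-1, i]
   ([vclass_st], [vclass_t]), and the relations become

     [g, i] = [g sigma, i+1] + [g sigma^-1, i+1],

   in which only the powers of sigma occur.  Let X be the operator of right
   translation by sigma on the functions g |-> [g, i].  Then X^n = 1, and p^m
   steps along the layer m lead back to the same i, so that X^(p^m) acts as
   (X^2 + 1)^(p^m) ([vclass_fun_full_turn]).  Modulo p this is the equation
   w^2 - w + 1 = 0 for w = X^(p^m): in characteristic p, the n-th root of unity
   w would be a root of the sixth cyclotomic polynomial.

   If no n-th root of unity in characteristic p is such a root, then 1 belongs
   to the ideal of the X-polynomials that act as 0 modulo p; by Nakayama the
   module of each layer is 0.  This settles all the cases but two: p = 2 with n
   odd and divisible by 3, where w is a primitive cube root of unity, and p = 3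
   with n even and prime to 3, where w = -1.  There n is prime to p, so that the
   equation passes from w to X, and it lifts from F_p to Z_p: exactly,
   1 + X + X^2 = 0, respectively 1 + X = 0 ([ann_cyclotomic]).  Substituting
   X + X^-1 = -1, respectively -2, in the relations shows that theta multiplies
   every class by u = -1, respectively u = -1/2.  The module of the layer m is
   then free of rank r = 2, respectively 1, over Z_p / (1 - u^(p^m)); freeness is
   proved by exhibiting functions on the dihedral group that satisfy the
   relations ([vclass_free]).

   It remains to identify the limit of such a tower of scalar modules
   ([scalar_tower_invariants]).  As a Z_p-module it is Z_p^r, with the generator
   gamma of Gamma' acting as a scalar u' congruent to 1 modulo p.  Every element
   of the Iwasawa algebra is a multiple of gamma - u' plus a constant
   ([iwasawa_division]), so that the limit is the r-th power of the quotient by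
   gamma - u' = T - (u' - 1), a distinguished polynomial of degree one in T.
   Hence mu = 0 and lambda = r.

   Components are dealt with by setting [g, i] = 0 when the vertex does not lie
   above the component of the base point: edges do not leave a component, so
   the relations hold for all g and i. *)

Set Implicit Arguments.
Unset Strict Implicit.
Unset Printing Implicit Defensive.

Import GRing.Theory.

(** * p-adic integers *)

Section PadicIntegers.
Local Open Scope ring_scope.
Variables (p : nat) (p_pr : prime p).
Local Notation Zp := (Defs.Zp p_pr).
Implicit Types a b : Zp.

Lemma Zp_val1 k : (1 : Zp) k = 1. Proof. by []. Qed.
Lemma Zp_valD a b k : (a + b) k = a k + b k. Proof. by []. Qed.
Lemma Zp_valM a b k : (a * b) k = a k * b k. Proof. by []. Qed.
Lemma Zp_valMn a n k : (a *+ n) k = a k *+ n.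
Proof. by elim: n => // n IH; rewrite !mulrS Zp_valD IH. Qed.

Lemma Zpow_natE k (x : Zpow p k) : x = (val x)%:R.
Proof. by rewrite natr_Zp. Qed.

Lemma Zpow_nat_eq0 k m : (p ^ k.+1 %| m)%N -> m%:R = 0 :> Zpow p k.
Proof.
by move=> dm; apply: (@Zpow_natr p p_pr k m 0); rewrite mod0n; apply/eqP.
Qed.

Lemma Zpow_val_nat k m : val (m%:R : Zpow p k) = (m %% p ^ k.+1)%N.
Proof. by rewrite /= val_Zp_nat // Zpow_gt1. Qed.

Lemma Zp_ppow_val_eq0 m k : (k < m)%N -> (p%:R ^+ m : Zp) k = 0.
Proof.
move=> km; rewrite -natrX Zp_valMn Zp_val1; apply: Zpow_nat_eq0.
exact: dvdn_exp2l.
Qed.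

Lemma Zp_val_ppow m a k : (k < m)%N -> (p%:R ^+ m * a) k = 0.
Proof. by move=> km; rewrite Zp_valM Zp_ppow_val_eq0 // mul0r. Qed.

Lemma Zp_val_red a k : (val (a k.+1) %% p ^ k.+1)%N = val (a k).
Proof. by rewrite -[in RHS](rl_compat a k) [RHS]Zpow_val_nat. Qed.

Lemma Zp_val_redn a k j : (val (a (k + j)%N) %% p ^ k.+1)%N = val (a k).
Proof.
elim: j => [|j IH].
  by rewrite addn0 modn_small //; have := ltn_ord (a k); rewrite {2}Zp_cast ?Zpow_gt1.
rewrite addnS -IH -[in RHS]Zp_val_red modn_dvdm //.
by rewrite dvdn_exp2l // ltnS leq_addr.
Qed.

Lemma Zp_val_eq0W a k j : (k <= j)%N -> a j = 0 -> a k = 0.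
Proof.
move=> kj aj0; apply: val_inj; rewrite -(Zp_val_redn a k (j - k)) subnKC // aj0.
by rewrite /= mod0n.
Qed.

(** The quotient by the power of p is computed component by component, each
   one being read off from a later component of the dividend. *)
Lemma Zp_val_eq0P a k : a k = 0 -> exists b, a = p%:R ^+ k.+1 * b.
Proof.
move=> ak0.
pose b j : Zpow p j := (val (a (k.+1 + j)%N) %/ p ^ k.+1)%:R.
have dv j : (p ^ k.+1 %| val (a (k.+1 + j)%N))%N.
  by rewrite /dvdn addSnnS Zp_val_redn ak0.
have bP j : rt_map (RingTower (Zpow_map p_pr)) j (b j.+1) = b j.
  rewrite [LHS](Zpow_red_nat p_pr); apply: Zpow_natr => //.
  have pk : (0 < p ^ k.+1)%N by rewrite expn_gt0 prime_gt0.
  apply/eqP; rewrite -(eqn_pmul2l pk) !muln_modr.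
  rewrite ![(p ^ k.+1 * (_ %/ _))%N]mulnC !divnK // -expnD addnS.
  by apply/eqP; rewrite -[in RHS]Zp_val_red modn_mod.
exists (RingLim bP); apply: ring_limP => j.
rewrite Zp_valM -natrX Zp_valMn Zp_val1 /= -natrM mulnC divnK //.
rewrite [LHS]Zpow_natE; apply: Zpow_natr => //.
by rewrite -(Zp_val_redn a j k.+1) modn_mod addnC.
Qed.

Lemma Zp_eq0P a : (forall k, exists b, a = p%:R ^+ k.+1 * b) -> a = 0.
Proof.
by move=> aP; apply: ring_limP => k; have [b ->] := aP k; apply: Zp_val_ppow.
Qed.

(** Inverses in the finite rings Z/p^(k+1) are unique, hence compatible. *)
Lemma Zp_invertible a : a 0%N != 0 -> exists b, a * b = 1.
Proof.
move=> a0.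
have cop k : coprime (p ^ k.+1) (val (a k)).
  rewrite coprime_pexpl // prime_coprime //; apply: contra a0 => dv.
  apply/eqP/val_inj; rewrite -(Zp_val_redn a 0 k); apply/eqP; exact: dv.
pose b k : Zpow p k := (a k : 'Z_(p ^ k.+1))^-1.
have ab k : a k * b k = 1.
  have un : (a k : 'Z_(p ^ k.+1)) \is a GRing.unit.
    by rewrite (Zpow_natE (a k)) unitZpE ?Zpow_gt1.
  exact: (@mulrV ('Z_(p ^ k.+1)) (a k) un).
have bP k : rt_map (RingTower (Zpow_map p_pr)) k (b k.+1) = b k.
  rewrite -[LHS]mul1r -(ab k) -mulrA mulrCA mulrC.
  by rewrite -{1}(rl_compat a k) -rmorphM ab rmorph1 mul1r.
by exists (RingLim bP); apply: ring_limP => k; apply: ab.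
Qed.

(** The exponent k is the valuation of a, found as the least index of a nonzero
   component. *)
Lemma Zp_neq0P a : a != 0 -> exists k b c, a = p%:R ^+ k * b /\ b * c = 1.
Proof.
move=> a_neq0.
have exk : exists k, a k != 0.
  apply: contrapT => nex; move/eqP: a_neq0; apply; apply: ring_limP => k.
  by apply/eqP/negP => /negP ak; apply: nex; exists k.
have [k ak min_k] := ex_minnP exk; exists k.
have [b ab] : exists b, a = p%:R ^+ k * b.
  case: k ak min_k => [|k] ak min_k; first by exists a; rewrite mul1r.
  apply: Zp_val_eq0P; apply/eqP; apply: contraT => /min_k; by rewrite ltnn.
exists b.
have [c bc] : exists c, b * c = 1.
  apply: Zp_invertible; apply: contra ak => /eqP /Zp_val_eq0P[c bE].
  by rewrite ab bE mulrA -exprD addn1 Zp_val_ppow.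
by exists c.
Qed.

Lemma Zp_nat_invertible m : coprime p m -> exists b : Zp, m%:R * b = 1.
Proof.
move=> pm; apply: Zp_invertible; rewrite Zp_valMn Zp_val1.
apply: contraL pm => /eqP m0; rewrite prime_coprime // negbK /dvdn.
by rewrite -[X in (_ %% X)%N]expn1 -Zpow_val_nat m0.
Qed.

End PadicIntegers.

(** * Convergent recursions and Nakayama over the p-adic integers *)

Section PadicLimits.
Local Open Scope ring_scope.
Variables (p : nat) (p_pr : prime p).
Local Notation Zp := (Defs.Zp p_pr).

(** The solution is d_k = c_k + e_k c_(k+1) + e_k e_(k+1) c_(k+2) + ...; the
   terms after the first j + 1 ones are multiples of p^(j+1), so that the partial
   sums give the j-th component. *)
Lemma Zp_recursion_solvable (c e : nat -> Zp) :
  (forall k, exists e', e k = p%:R * e') ->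
  exists d : nat -> Zp, forall k, d k = c k + e k * d k.+1.
Proof.
move=> eP.
(* D m k is the sum of the first m terms of the series for d k. *)
pose D := fix D m k : Zp := if m is m'.+1 then c k + e k * D m' k.+1 else 0.
have D_cauchy m k : exists b, D m.+1 k - D m k = p%:R ^+ m * b.
  elim: m k => [|m IH] k; first by exists (D 1%N k); rewrite subr0 mul1r.
  have [b bE] := IH k.+1; have [e' e'E] := eP k; exists (e' * b).
  rewrite -[D m.+2 k]/(c k + e k * D m.+1 k.+1) -[D m.+1 k in LHS]/(c k + e k * D m k.+1).
  by rewrite opprD addrACA subrr add0r -mulrBr bE e'E exprS; ring.
have dP k j : rt_map (RingTower (Zpow_map p_pr)) j (D j.+2 k j.+1) = D j.+1 k j.
  rewrite rl_compat; have [b bE] := D_cauchy j.+1 k.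
  by rewrite -[D j.+2 k](subrK (D j.+1 k)) bE Zp_valD Zp_val_ppow // add0r.
exists (fun k => RingLim (dP k)) => k; apply: ring_limP => j.
have [b bE] := D_cauchy j k.+1; have [e' e'E] := eP k.
rewrite -[LHS]/((c k + e k * D j k.+1) j) -[RHS]/((c k + e k * D j.+1 k.+1) j).
rewrite -[D j.+1 k.+1](subrK (D j k.+1)) bE mulrDr Zp_valD [in RHS]Zp_valD.
congr (_ + _); rewrite Zp_valD -[LHS]add0r; congr (_ + _).
by rewrite e'E mulrACA -exprS Zp_val_ppow.
Qed.

(** Reduction modulo p, as a ring morphism so that it commutes with
   determinants. *)
Definition Zp_residue (a : Zp) : Zpow p 0 := a 0%N.

Lemma Zp_residue_zmod : zmod_morphism Zp_residue. Proof. by []. Qed.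
Lemma Zp_residue_monoid : monoid_morphism Zp_residue. Proof. by []. Qed.

HB.instance Definition _ := GRing.isZmodMorphism.Build Zp (Zpow p 0) Zp_residue
  Zp_residue_zmod.
HB.instance Definition _ := GRing.isMonoidMorphism.Build Zp (Zpow p 0) Zp_residue
  Zp_residue_monoid.

(** The matrix 1 - p a kills the column z, hence so does its determinant by the
   adjugate formula; this determinant is 1 modulo p, thus a unit. *)
Lemma Zp_nakayama (V : lmodType Zp) n (z : 'I_n -> V) (a : 'I_n -> 'I_n -> Zp) :
  (forall i, z i = p%:R *: \sum_j a i j *: z j) -> forall i, z i = 0.
Proof.
move=> zE i.
pose B : 'M[Zp]_n := 1%:M - p%:R *: \matrix_(i, j) a i j.
have Bz j : \sum_l B j l *: z l = 0.
  under eq_bigr => l _ do rewrite !mxE scalerBl -scalerA.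
  rewrite sumrB -scaler_sumr -zE (bigD1 j) //= eqxx scale1r big1 ?addr0 ?subrr //.
  by move=> l /negbTE; rewrite eq_sym => ->; rewrite scale0r.
have [b detB] : exists b, \det B * b = 1.
  apply: Zp_invertible; rewrite -[X in X != 0]/(Zp_residue (\det B)) -det_map_mx.
  rewrite (_ : map_mx _ _ = 1%:M) ?det1 ?oner_eq0 //.
  apply/matrixP => j l; rewrite !mxE rmorphB rmorphM /= [X in X * _]/Zp_residue.
  by rewrite -[p%:R]expr1 Zp_ppow_val_eq0 // mul0r subr0 rmorph_nat.
have : \det B *: z i = 0.
  transitivity (\sum_l (\adj B *m B) i l *: z l).
    rewrite mul_adj_mx (bigD1 i) //= mxE eqxx big1 ?addr0 //.
    by move=> l /negbTE; rewrite eq_sym mxE => ->; rewrite scale0r.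
  under eq_bigr => l _ do rewrite mxE scaler_suml.
  rewrite exchange_big /=; apply: big1 => j _.
  under eq_bigr => l _ do rewrite -scalerA.
  by rewrite -scaler_sumr Bz scaler0.
by move/(congr1 (fun v => b *: v)); rewrite scalerA mulrC detB scale1r scaler0.
Qed.

End PadicLimits.

(** * Division by gamma - u in the Iwasawa algebra *)

Section WeierstrassDivision.
Local Open Scope ring_scope.
Variables (p : nat) (p_pr : prime p).
Local Notation Zp := (Defs.Zp p_pr).
Local Notation L := (iwasawa p_pr Zp).
Local Notation W := (cyc_poly p Zp).
Local Notation "q %:W k" := (in_qpoly (W k) q : cyc_ring p Zp k) (at level 2, k at level 1).

Lemma monic_mulI (R : comNzRingType) (m q r : {poly R}) :
  m \is monic -> m * q = m * r -> q = r.
Proof.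
move=> /monicP m1; have := @lreg_lead R m; rewrite m1; apply.
exact: lreg1.
Qed.

Lemma cyc_eqP k (q r : {poly Zp}) :
  q %:W k = r %:W k <-> exists h, q = r + h * W k.
Proof.
split=> [E|[h ->]]; last by rewrite in_qpolyD in_qpoly_eq0 // addr0.
have mon := monic_cyc_poly p_pr Zp k.
exists (Pdiv.Ring.rdivp (q - r) (W k)).
have /(congr1 val) /= : (q - r) %:W k = 0.
  by apply: (addIr (r %:W k)); rewrite -in_qpolyD subrK add0r.
rewrite mk_monic_cyc // => E0.
by have := Pdiv.RingMonic.rdivp_eq mon (q - r); rewrite E0 addr0 => <-; rewrite addrC subrK.
Qed.

Variables (u : Zp).
Hypothesis u1 : exists c, u = 1 + p%:R * c.
Local Notation U k := (u ^+ (p ^ k)).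
Local Notation lin := ('X - u%:P).

Lemma unipotent_pow k : exists c, U k = 1 + p%:R ^+ k.+1 * c.
Proof.
elim: k => [|k [c cE]]; first by rewrite expn0 !expr1.
rewrite expnSr exprM cE.
have key (R : comPzRingType) (x : R) n : exists d, (1 + x) ^+ n = 1 + n%:R * x + x ^+ 2 * d.
  elim: n => [|n [d dE]]; first by exists 0; rewrite expr0; ring.
  by exists (d + n%:R + x * d); rewrite exprS dE -natr1; ring.
have [d ->] := key _ (p%:R ^+ k.+1 * c) p.
(* (p^(k+1) c)^2 is divisible by p^(k+2). *)
exists (c + p%:R ^+ k * c ^+ 2 * d); rewrite !exprS; move: (p%:R ^+ k) => P; ring.
Qed.

Lemma unipotent_pow_modp k : exists c, U k = 1 + p%:R * c.
Proof.
by have [c ->] := unipotent_pow k; exists (p%:R ^+ k * c); rewrite exprS mulrA.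
Qed.

(** The quotient of X^(p^k) - u^(p^k) by X - u. *)
Definition geom_quot k : {poly Zp} := \sum_(i < p ^ k) 'X^((p ^ k).-1 - i) * u%:P ^+ i.

Lemma geom_quotE k : lin * geom_quot k = 'X^(p ^ k) - (U k)%:P.
Proof. by rewrite -subrXX polyC_exp. Qed.

Lemma cyc_poly_geom k : W k = lin * geom_quot k + (U k - 1)%:P.
Proof. by rewrite geom_quotE /cyc_poly polyCB addrA subrK. Qed.

(** For Y = X^(p^k), the quotient of index k + 1 is the one of index k times the
   quotient of Y^p - u^(p^(k+1)) by Y - u^(p^k), and Y is 1 modulo [cyc_poly k]:
   what remains is the sum e of p powers of u^(p^k), all congruent to 1. *)
Lemma geom_quot_red k : exists e h,
  geom_quot k.+1 = e%:P * geom_quot k + h * W k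
  /\ e * (1 - U k) = 1 - U k.+1 /\ exists e', e = p%:R * e'.
Proof.
pose e := \sum_(t < p) U k ^+ t.
pose S := \sum_(t < p) 'X^(p ^ k) ^+ (p.-1 - t) * (U k)%:P ^+ t : {poly Zp}.
have nuS : geom_quot k.+1 = geom_quot k * S.
  apply: (monic_mulI (monicXsubC u)); rewrite mulrA !geom_quotE /S -subrXX.
  by rewrite -!exprM -polyC_exp -!exprM -expnSr.
have [h hE] : exists h, S - e%:P = h * W k.
  rewrite /S /e rmorph_sum -sumrB.
  (* Y^(p-1-t) - 1 is Y - 1 times this geometric sum. *)
  pose g (t : 'I_p) : {poly Zp} := \sum_(i < p.-1 - t) 'X^(p ^ k) ^+ i.
  exists (\sum_(t < p) g t * (U k)%:P ^+ t); rewrite mulr_suml.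
  apply: eq_bigr => t _; rewrite [X in _ - X](_ : _ = 1 * (U k)%:P ^+ t) -?mulrBl; last first.
    by rewrite mul1r -polyC_exp.
  by rewrite subrX1 /cyc_poly /g; move: (\sum_(_ < _) _) => Q; ring.
exists e, (geom_quot k * h); split.
  have SE : S = e%:P + h * W k by rewrite -hE addrC subrK.
  by rewrite nuS SE; ring.
split; first by rewrite mulrC -opprB mulNr -subrX1 opprB -exprM -expnSr.
have [c cE] := unipotent_pow k.
suff /Zp_val_eq0P[e' ->] : e 0%N = 0 by exists e'; rewrite expr1.
rewrite -[e 0%N]/(Zp_residue e) rmorph_sum (eq_bigr (fun _ => 1)) => [|t _].
  by rewrite sumr_const card_ord Zpow_nat_eq0.
by rewrite rmorphXn /= cE [Zp_residue _]Zp_valD Zp_val_ppow // addr0 expr1n.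
Qed.

(** Division by X - u of polynomials lifting the components of q yields quotients
   S_k that need not be compatible: the image of S_(k+1) at level k is
   S_k + c_k nu_k for nu_k = [geom_quot k].  As nu_(k+1) becomes e_k nu_k there,
   S_k + d_k nu_k is compatible when d_k = c_k + e_k d_(k+1), a recursion that
   converges because p divides e_k.  The remainders are then constant in k. *)
Lemma iwasawa_division (q : L) :
  exists s a, q = (iw_gen p_pr Zp - iw_const p_pr u) * s + iw_const p_pr a.
Proof.
pose Q k : {poly Zp} := (q k : {poly Zp}).
have QE k : (Q k) %:W k = q k by apply: qpolyK.
have /choice[H HP] k : exists h, Q k.+1 = Q k + h * W k.
  by apply/cyc_eqP; rewrite QE -(rl_compat q k) -[in RHS]QE [RHS]cyc_redE.
have lin_div (f : {poly Zp}) : exists g, f = lin * g + (f.[u])%:P.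
  have /factor_theorem[g gE] : root (f - f.[u]%:P) u.
    by rewrite /root !hornerE subrr.
  by exists g; rewrite mulrC -gE subrK.
have /choice[S SP] k := lin_div (Q k).
have /choice[H1 H1P] k := lin_div (H k).
have /choice[e eP] k := geom_quot_red k.
have [|d dP] := @Zp_recursion_solvable _ p_pr (fun k => (H k).[u]) e.
  by move=> k; have [h [_ []]] := eP k.
have QU k : (Q k.+1).[u] = (Q k).[u] + (H k).[u] * (U k - 1).
  by rewrite HP !hornerE.
have SS k : S k.+1 = S k + H1 k * W k + (H k).[u]%:P * geom_quot k.
  apply: (monic_mulI (monicXsubC u)).
  transitivity (Q k.+1 - (Q k.+1).[u]%:P); first by rewrite {1}SP addrK.
  rewrite QU HP {1}(SP k) {1}(H1P k) polyCD polyCM.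
  have := cyc_poly_geom k; move: (W k) (geom_quot k) => w g wE.
  rewrite (_ : (U k - 1)%:P = w - lin * g); last first.
    by rewrite wE addrAC subrr add0r.
  ring.
have sP k : rt_map (iwasawa_tower p_pr Zp) k
    ((S k.+1 + (d k.+1)%:P * geom_quot k.+1) %:W k.+1) =
    (S k + (d k)%:P * geom_quot k) %:W k.
  rewrite [LHS]cyc_redE //; refine (iffRL (cyc_eqP k _ _) _).
  have [h [-> _]] := eP k; exists (H1 k + (d k.+1)%:P * h); rewrite SS (dP k) polyCD polyCM; ring.
pose E k := (Q k).[u] - d k * (1 - U k).
have EE k : E k = E 0%N.
  elim: k => // k <-; have [h [_ [e1 _]]] := eP k.
  by rewrite /E QU (dP k) -e1; ring.
exists (RingLim sP), (E 0%N); apply: ring_limP => k.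
rewrite -(EE k).
transitivity ((lin * (S k + (d k)%:P * geom_quot k) + (E k)%:P) %:W k).
  rewrite -QE; apply/cyc_eqP; exists (- (d k)%:P).
  rewrite {1}SP cyc_poly_geom /E !(polyCB, polyCM, polyCN, polyC1); ring.
rewrite in_qpolyD in_qpolyM; congr (_ * _ + _).
by rewrite /= -raddfB.
Qed.

(** Substituting u for X at level k shows that a is a multiple of 1 - u^(p^k),
   thus of p^(k+1), for every k. *)
Lemma iw_const_in_linear (a : Zp) (s : L) :
  iw_const p_pr a = (iw_gen p_pr Zp - iw_const p_pr u) * s -> a = 0.
Proof.
move=> E; apply: Zp_eq0P => k.
have /(congr1 (fun q : L => q k)) /= := E.
rewrite -(qpolyK (s k)) => E'.
have : (a%:P) %:W k = (lin * (s k : {poly Zp})) %:W k.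
  by rewrite in_qpolyM [LHS]E'; congr (_ * _); rewrite raddfB.
case/cyc_eqP=> h /(congr1 (fun f => f.[u])).
have [c cE] := unipotent_pow k.
rewrite !hornerE subrr mul0r add0r cE => ->.
by exists (h.[u] * c); ring.
Qed.

End WeierstrassDivision.

(** * Limits of towers on which gamma acts as a scalar *)

Section ScalarTower.
Local Open Scope ring_scope.
Variables (p : nat) (p_pr : prime p).
Local Notation Zp := (Defs.Zp p_pr).
Local Notation L := (iwasawa p_pr Zp).

Lemma iw_constD (a b : Zp) : iw_const p_pr (a + b) = iw_const p_pr a + iw_const p_pr b.
Proof. by apply: ring_limP => k; rewrite /= polyCD in_qpolyD. Qed.

Lemma iw_constM (a b : Zp) : iw_const p_pr (a * b) = iw_const p_pr a * iw_const p_pr b.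
Proof. by apply: ring_limP => k; rewrite /= polyCM in_qpolyM. Qed.

Lemma iw_const0 : iw_const p_pr (0 : Zp) = 0.
Proof. by apply: (addIr (iw_const p_pr 0)); rewrite -iw_constD !add0r. Qed.

Lemma iw_const1 : iw_const p_pr (1 : Zp) = 1.
Proof. by apply: ring_limP => k; apply: in_qpoly1. Qed.

Lemma iw_constB (a b : Zp) : iw_const p_pr (a - b) = iw_const p_pr a - iw_const p_pr b.
Proof. by apply: (addIr (iw_const p_pr b)); rewrite -iw_constD !subrK. Qed.

Lemma iw_eval_linear (u : Zp) :
  iw_eval p_pr ('X - (u - 1)%:P) = iw_gen p_pr Zp - iw_const p_pr u.
Proof.
have E : map_poly (@iw_const p p_pr Zp) ('X - (u - 1)%:P) = 'X - (iw_const p_pr (u - 1))%:P.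
  apply/polyP => i; rewrite coef_map_id0 ?iw_const0 // !coefB !coefX !coefC.
  by rewrite iw_constB; case: i => [|[|i]] /=; rewrite ?iw_const0 ?iw_const1.
by rewrite /iw_eval E !hornerE /iw_T iw_constB iw_const1; ring.
Qed.

Lemma distinguished_linear (u : Zp) : (exists c, u = 1 + p%:R * c) ->
  distinguished ('X - (u - 1)%:P).
Proof.
case=> c ->; split=> [|i]; first exact: monicXsubC.
rewrite size_XsubC; case: i => // _; exists (- c).
by rewrite coefB coefX coefC /=; ring.
Qed.

Lemma iw_poly_scale (M : mod_tower p Zp) (q : {poly Zp}) (x : mod_lim M) k :
  ((iw_poly p_pr q : L) *: x) k = poly_act (mt_gen M k) q (x k).
Proof. by rewrite [LHS]poly_act_mod //; apply: mt_genX. Qed.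

Lemma iw_const_scale (M : mod_tower p Zp) (a : Zp) (x : mod_lim M) k :
  ((iw_const p_pr a : L) *: x) k = a *: x k.
Proof. by rewrite [LHS]iw_poly_scale poly_actC. Qed.

Lemma iw_gen_scale (M : mod_tower p Zp) (x : mod_lim M) k :
  ((iw_gen p_pr Zp : L) *: x) k = mt_gen M k (x k).
Proof. by rewrite [LHS]iw_poly_scale -['X]expr1 poly_actXn. Qed.

(** The universal property of a finite power, in the form needed for the nested
   pairs of [elementary_module]; the second clause reduces the surjectivity of
   phi to the joint surjectivity of the f i. *)
Lemma elementary_nseq_map (V : lmodType L) (g : L) r
    (f : 'I_r -> {linear V -> cyclic_module g}) :
  exists phi : {linear V -> elementary_module (nseq r g)},
    (forall x, phi x = 0 -> forall i, f i x = 0) /\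
    (forall z, exists y, forall x, (forall i, f i x = y i) -> phi x = z).
Proof.
elim: r f => [|r IH] f.
  have lin0 : linear (fun x : V => 0 : elementary_module (nseq 0 g)).
    by move=> a x y; rewrite scaler0 addr0.
  exists (mk_linear lin0); split=> [x _ []|z] //.
  exists (fun _ => 0) => x _; apply/matrixP => i [] //.
have [phi [phi0 phiS]] := IH (fun i => f (fintype.lift ord0 i)).
have lin : linear (fun x : V => (f ord0 x, phi x) : elementary_module (nseq r.+1 g)).
  by move=> a x y; rewrite !linearP.
exists (mk_linear lin); split=> [x [f0 phix] i|[z0 z]].
  by case: (unliftP ord0 i) => [j ->|-> //]; apply: phi0.
have [y yP] := phiS z; exists (fun i => if unlift ord0 i is Some j then y j else z0).
move=> x xP; apply: (congr2 pair); first by rewrite xP unlift_none.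
by apply: yP => i; rewrite xP liftK.
Qed.

Variables (M : mod_tower p Zp) (r : nat) (u : Zp) (e : forall k, 'I_r -> M k).
Arguments e : clear implicits.
Hypothesis u1 : exists c, u = 1 + p%:R * c.
Hypothesis e_compat : forall k i, mt_map M k (e k.+1 i) = e k i.
Hypothesis e_gen : forall k i, mt_gen M k (e k i) = u *: e k i.
Hypothesis e_span : forall k x, exists a, x = \sum_i a i *: e k i.
Hypothesis e_free : forall k a, \sum_i a i *: e k i = 0 ->
  forall i, exists b, a i = b * (1 - u ^+ (p ^ k)).

Local Notation U k := (u ^+ (p ^ k)).

Lemma mt_gen_scalar k (x : M k) : mt_gen M k x = u *: x.
Proof.
have [a ->] := e_span x; rewrite linear_sum scaler_sumr; apply: eq_bigr => i _.
by rewrite linearZ /= e_gen !scalerA mulrC.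
Qed.

(** The p^k-th iterate of gamma is the identity at level k. *)
Lemma unipotent_torsion k (x : M k) : (1 - U k) *: x = 0.
Proof.
rewrite scalerBl scale1r -[X in X - _](mt_genX (m := M)).
suff -> n : iter n (mt_gen M k) x = u ^+ n *: x by rewrite subrr.
by elim: n => [|n IH]; rewrite ?scale1r // iterS IH linearZ /= mt_gen_scalar scalerA exprSr.
Qed.

Lemma component_unique k (a b : 'I_r -> Zp) :
  \sum_i a i *: e k i = \sum_i b i *: e k i ->
  forall i, exists c, a i = b i + c * (1 - U k).
Proof.
move=> ab i; have [|c cE] := @e_free k (fun i => a i - b i) _ i.
  by under eq_bigr => j _ do rewrite scalerBl; rewrite sumrB ab subrr.
by exists c; rewrite -cE addrC subrK.
Qed.

Lemma unipotent_val k n (c : Zp) : (n <= k)%N -> (c * (1 - U k)) n = 0.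
Proof.
move=> nk; have [d ->] := unipotent_pow u1 k.
rewrite (_ : _ * _ = p%:R ^+ k.+1 * (- c * d)); last by ring.
by rewrite Zp_val_ppow.
Qed.

(** A compatible system is x = (sum_i a_(k,i) e_(k,i))_k with a_(k,i) well
   defined modulo 1 - u^(p^k), which p^(k+1) divides: so the k-th component of
   the i-th coordinate of x is well defined.

   For the injectivity, let these coordinates vanish.  Then a_(k,i) differs by a
   multiple of 1 - u^(p^k) from a_(k+n,i), which p^(k+n+1) divides.  Since
   1 - u^(p^k) is 0 or a unit times a power of p, it divides a_(k,i), and
   a_(k,i) e_(k,i) = 0. *)
Lemma scalar_tower_coord :
  exists phi : 'I_r -> mod_lim M -> Zp,
    (forall (x : mod_lim M) k a, x k = \sum_i a i *: e k i -> forall i, phi i x k = a i k) /\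
    (forall x, (forall i, phi i x = 0) -> x = 0).
Proof.
have /choice[A' AP'] (kx : nat * mod_lim M) : exists a, kx.2 kx.1 = \sum_i a i *: e kx.1 i.
  exact: e_span.
pose A k x := A' (k, x); have AP k (x : mod_lim M) : x k = \sum_i A k x i *: e k i := AP' (k, x).
have AS (x : mod_lim M) k i : exists c, A k.+1 x i = A k x i + c * (1 - U k).
  apply: component_unique; rewrite -AP -(ml_compat x k) [x k.+1]AP linear_sum.
  by apply: eq_bigr => j _; rewrite linearZ /= e_compat.
have phiP i (x : mod_lim M) k : rt_map (RingTower (Zpow_map p_pr)) k (A k.+1 x i k.+1)
    = A k x i k.
  by rewrite rl_compat; have [c ->] := AS x k i; rewrite Zp_valD unipotent_val // addr0.
exists (fun i x => RingLim (phiP i x)); split=> [x k a xE i|x x0] /=.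
  have [c ->] : exists c, A k x i = a i + c * (1 - U k).
    by apply: component_unique; rewrite -AP.
  by rewrite Zp_valD unipotent_val // addr0.
have AI k n i : exists c, A (k + n)%N x i = A k x i + c * (1 - U k).
  elim: n => [|n [c cE]]; first by exists 0; rewrite addn0 mul0r addr0.
  have [d dE] := AS x (k + n)%N i; rewrite addnS dE cE.
  have [h hE] : exists h, 1 - U (k + n)%N = h * (1 - U k).
    exists (\sum_(j < p ^ n) U k ^+ j).
    by rewrite expnD exprM -opprB subrX1 -[in RHS]opprB mulrN mulrC.
  by exists (c + d * h); rewrite hE; ring.
apply: mod_limP => k; rewrite [x k]AP; apply: big1 => i _.
have A0 n : A (k + n)%N x i (k + n)%N = 0.
  by have /(congr1 (fun a : Zp => a (k + n)%N)) := x0 i.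
suff [c ->] : exists c, A k x i = c * (1 - U k).
  by rewrite -scalerA unipotent_torsion scaler0.
have [U0|/Zp_neq0P[l [b [b' [UE bb']]]]] := eqVneq (1 - U k) 0.
  exists 0; rewrite mul0r; apply: ring_limP => n.
  have [c E] := AI k n i; move: (A0 n); rewrite E U0 mulr0 addr0.
  by apply: Zp_val_eq0W; apply: leq_addl.
have [c E] := AI k l i; have [d dE] := Zp_val_eq0P (A0 l).
exists (p%:R ^+ k.+1 * b' * d - c); rewrite mulrBl UE.
apply: (addIr (c * (1 - U k))); rewrite -E dE UE subrK -addSn exprD.
transitivity (p%:R ^+ k.+1 * p%:R ^+ l * d * (b * b')); first by rewrite bb' mulr1.
by move: (p%:R ^+ k.+1) (p%:R ^+ l) => P Q; ring.
Qed.

Lemma scalar_tower_surj (phi : 'I_r -> mod_lim M -> Zp) :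
  (forall (x : mod_lim M) k a, x k = \sum_i a i *: e k i -> forall i, phi i x k = a i k) ->
  forall b, exists x, forall i, phi i x = b i.
Proof.
move=> phiP b.
have xP k : mt_map M k (\sum_i b i *: e k.+1 i) = \sum_i b i *: e k i.
  by rewrite linear_sum; apply: eq_bigr => i _; rewrite linearZ /= e_compat.
by exists (ModLim xP) => i; apply: ring_limP => k; apply: (phiP _ k b).
Qed.

(** The coordinates identify the limit with Zp^r, and gamma acts as u.  By
   division by gamma - u, the constants map isomorphically from Zp to the cyclic
   module of gamma - u, and this makes the coordinates Iwasawa-linear. *)
Theorem scalar_tower_invariants : iwasawa_invariants (mod_lim M : lmodType L) 0 r.
Proof.
have [phi [phiP phi_inj]] := scalar_tower_coord.
have phi_surj := scalar_tower_surj phiP.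
have phiD i (x y : mod_lim M) : phi i (x + y) = phi i x + phi i y.
  apply: ring_limP => k; have [a xE] := e_span (x k); have [b yE] := e_span (y k).
  rewrite Zp_valD (phiP x k a) // (phiP y k b) // -Zp_valD.
  apply: (phiP _ k (fun j => a j + b j)).
  rewrite -[(x + y) k]/(x k + y k) xE yE -big_split.
  by apply: eq_bigr => j _; rewrite scalerDl.
have phiZ i c (x y : mod_lim M) : (forall k, y k = c *: x k) -> phi i y = c * phi i x.
  move=> yE; apply: ring_limP => k; have [a xE] := e_span (x k).
  rewrite Zp_valM (phiP x k a) // -Zp_valM.
  apply: (phiP _ k (fun j => c * a j)).
  rewrite yE xE scaler_sumr.
  by apply: eq_bigr => j _; rewrite scalerA.
pose g : L := iw_gen p_pr Zp - iw_const p_pr u.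
have phi_act i s a x : phi i ((g * s + iw_const p_pr a) *: x) = a * phi i x.
  rewrite scalerDl phiD -scalerA; set z := s *: x.
  rewrite (phiZ i a x (iw_const p_pr a *: x)); last exact: iw_const_scale.
  rewrite scalerBl.
  have := phiD i (iw_gen p_pr Zp *: z - iw_const p_pr u *: z) (iw_const p_pr u *: z).
  rewrite subrK (phiZ i u z (iw_const p_pr u *: z)); last exact: iw_const_scale.
  rewrite (phiZ i u z (iw_gen p_pr Zp *: z)); last first.
    by move=> k; rewrite iw_gen_scale mt_gen_scalar.
  by move=> E; rewrite -[X in X + _](addrK (u * phi i z)) -E subrr add0r.
have qE (v w : L) : (exists s, v - w = g * s) ->
    qproj (fun x : L^o => x = g) v = qproj (fun x : L^o => x = g) w.
  case=> s E; apply/qprojP; rewrite [_ - _]E mulrC.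
  by rewrite -[_ * _]/(s *: (g : L^o)); apply/spanZ/spanS.
pose psi i (x : mod_lim M) : cyclic_module g :=
  qproj (fun x : L^o => x = g) (iw_const p_pr (phi i x)).
have lin i : linear (psi i).
  move=> q x y; rewrite /psi; have [s [a ->]] := iwasawa_division u1 q.
  rewrite phiD phi_act iw_constD qprojD; congr (_ + _).
  rewrite -[RHS]/(qscale _ (qproj _ _)) -qprojZ; apply: qE; exists (- s * iw_const p_pr (phi i x)).
  by rewrite -[_ *: _]/((g * s + iw_const p_pr a) * _) iw_constM; ring.
have [Phi [Phi0 PhiS]] := elementary_nseq_map (fun i => mk_linear (lin i)).
exists [::], (nseq r ('X - (u - 1)%:P)); split=> //.
- by move=> f /nseqP[-> _]; apply: distinguished_linear.
- by rewrite big_nil.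
- by rewrite big_nseq size_XsubC iter_addn addn0 mul1n.
rewrite map_nseq iw_eval_linear /=; exists Phi; split.
  apply: (sub_finite_set _ (finite_set1 0)) => x /Phi0 x0; apply: phi_inj => i.
  have /qprojP := etrans (x0 i) (esym (linear0 (qproj (fun x : L^o => x = g)))).
  rewrite subr0 => span_phi.
  suff [s sE] : exists s, iw_const p_pr (phi i x) = g * s by apply: iw_const_in_linear sE.
  elim: span_phi => [|a v w -> _ [s ->]]; first by exists 0; rewrite mulr0.
  by exists (a + s); rewrite mulrDr [g * a]mulrC.
apply: (sub_finite_set _ (finite_set1 0)) => z _.
rewrite -[z]qreprK -[0](linear0 (qproj _)); apply/qprojP; rewrite subr0; apply: spanS.
have [y yP] := PhiS (qrepr z).
have /choice[b bP] i : exists b, y i = qproj (fun x : L^o => x = g) (iw_const p_pr b).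
  have [s [b E]] := iwasawa_division u1 (qrepr (y i)); exists b.
  by rewrite -[y i]qreprK; apply: qE; exists s; rewrite E addrK.
have [x xE] := phi_surj b; exists x; rewrite -(yP x) // => i.
by rewrite -[LHS]/(psi i x) /psi xE bP.
Qed.

End ScalarTower.

(** * Sixth roots of unity that are n-th roots of unity *)

Section SixthRootsOfUnity.
Local Open Scope ring_scope.
Variables (R : comNzRingType) (I : R -> Prop).
Hypothesis idealD : forall a b, I a -> I b -> I (a + b).
Hypothesis idealM : forall a b, I b -> I (a * b).

Lemma idealN a : I a -> I (- a).
Proof. by move=> Ia; rewrite -mulN1r; apply: idealM. Qed.

Lemma idealB a b : I a -> I b -> I (a - b).
Proof. by move=> Ia Ib; apply: idealD => //; apply: idealN. Qed.

Lemma idealX a b n : I (a - b) -> I (a ^+ n - b ^+ n).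
Proof. by move=> Iab; rewrite subrXX mulrC; apply: idealM. Qed.

Lemma idealX1 a n : I (a - 1) -> I (a ^+ n - 1).
Proof. by move=> Ia; rewrite -(expr1n _ n); apply: idealX. Qed.

Lemma ideal_expr_mod a n q r : I (a ^+ q - 1) -> I (a ^+ (n * q + r) - 1) -> I (a ^+ r - 1).
Proof.
move=> /(@idealX1 _ n) Iq Inr.
have E : a ^+ r - 1 = (a ^+ (n * q + r) - 1) - a ^+ r * ((a ^+ q) ^+ n - 1).
  by rewrite exprD mulnC exprM; move: ((a ^+ q) ^+ n) (a ^+ r) => x y; ring.
by rewrite E; apply: idealB => //; apply: idealM.
Qed.

Variables (w : R) (n : nat).
Hypothesis Iw : I (w ^+ 2 - w + 1).
Hypothesis In : I (w ^+ n - 1).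

Lemma ideal_cube : I (w ^+ 3 + 1).
Proof. by rewrite (_ : _ + _ = (w + 1) * (w ^+ 2 - w + 1)); [apply: idealM | ring]. Qed.

Lemma ideal_sixth : I (w ^+ 6 - 1).
Proof.
rewrite (_ : _ - _ = (w ^+ 3 - 1) * (w ^+ 3 + 1)); last by ring.
exact/idealM/ideal_cube.
Qed.

(** From w^3 = -1 and w^n = 1 with n odd, -1 = w^(3 n) = 1. *)
Lemma ideal_contains_2 : odd n -> I 2.
Proof.
move=> n_odd.
have I1 : I ((- w ^+ 3) ^+ n - 1).
  by apply: idealX1; rewrite -opprD; apply/idealN/ideal_cube.
have I2 := @idealX1 _ 3 In.
rewrite exprNn -signr_odd n_odd expr1 mulN1r exprAC in I1.
rewrite (_ : 2 = - ((- (w ^+ n) ^+ 3 - 1) + ((w ^+ n) ^+ 3 - 1))); last by ring.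
by apply/idealN/idealD.
Qed.

(** In characteristic 2, w^3 = 1 and w^n = 1 leave w = 1, which is not a root of
   w^2 - w + 1. *)
Lemma ideal_contains_1 : I 2 -> ~~ (3 %| n)%N -> I 1.
Proof.
move=> I2 n3.
have I3 : I (w ^+ 3 - 1).
  rewrite (_ : _ - _ = (w ^+ 3 + 1) - 2); last by ring.
  by apply: idealB => //; apply: ideal_cube.
have In' := In; rewrite (divn_eq n 3) in In'.
have {In'} := ideal_expr_mod I3 In'.
have I1 : I (w - 1) -> I 1.
  move=> Iw1; rewrite (_ : 1 = (w ^+ 2 - w + 1) - w * (w - 1)); last by ring.
  by apply: idealB => //; apply: idealM.
move: n3; rewrite /dvdn; case: (n %% 3)%N (ltn_pmod n (isT : 0 < 3)%N) => [|[|[|]]] //= _ _.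
move=> Iw2; apply: I1; rewrite (_ : w - 1 = (w ^+ 3 - 1) - w * (w ^+ 2 - 1)); last by ring.
by apply: idealB => //; apply: idealM.
Qed.

(** From w^6 = 1 and w^n = 1, where 2 is the greatest common divisor of n and 6. *)
Lemma ideal_sqr : ~~ odd n -> ~~ (3 %| n)%N -> I (w ^+ 2 - 1).
Proof.
move=> n2 n3; have In' := In; rewrite (divn_eq n 6) in In'.
have {In'} := ideal_expr_mod ideal_sixth In'.
have : ~~ odd (n %% 6) by rewrite odd_mod.
have : ~~ (3 %| n %% 6)%N by rewrite /dvdn modn_dvdm.
case: (n %% 6)%N (ltn_pmod n (isT : 0 < 6)%N) => [|[|[|[|[|[|]]]]]] //= _ _ _.
move=> Iw4; rewrite (_ : w ^+ 2 - 1 = (w ^+ 6 - 1) - w ^+ 2 * (w ^+ 4 - 1)); last by ring.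
by apply: idealB; [apply: ideal_sixth | apply: idealM].
Qed.

(** A root of w^2 - w + 1 = 0 with w^2 = 1 is w = 2, and then 4 = 1. *)
Lemma ideal_contains_3 : ~~ odd n -> ~~ (3 %| n)%N -> I 3.
Proof.
move=> n2 n3; have Iw2 := ideal_sqr n2 n3.
have Iw1 : I (w - 2).
  rewrite (_ : w - 2 = (w ^+ 2 - 1) - (w ^+ 2 - w + 1)); last by ring.
  exact: idealB.
rewrite (_ : 3 = (w ^+ 2 - 1) - (w + 2) * (w - 2)); last by ring.
by apply: idealB => //; apply: idealM.
Qed.

End SixthRootsOfUnity.

(** * The annihilator of a vector, modulo p and over the p-adic integers *)

Section Annihilator.
Local Open Scope ring_scope.
Variables (p : nat) (p_pr : prime p).
Local Notation Zp := (Defs.Zp p_pr).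

Lemma frobenius_pow (R : comNzRingType) (a b : R) j :
  exists c, (a + b) ^+ (p ^ j) = a ^+ (p ^ j) + b ^+ (p ^ j) + p%:R * c.
Proof.
have step (x y : R) : exists c, (x + y) ^+ p = x ^+ p + y ^+ p + p%:R * c.
  have aux m : prime m.+1 -> exists c,
      (x + y) ^+ m.+1 = x ^+ m.+1 + y ^+ m.+1 + m.+1%:R * c.
    move=> m_pr; exists (\sum_(i < m) (('C(m.+1, i.+1) %/ m.+1)%:R * (x ^+ (m - i) * y ^+ i.+1))).
    rewrite exprDn big_ord_recr big_ord_recl /= subn0 subnn bin0 binn.
    rewrite !expr0 !mulr1 !mul1r !mulr1n addrAC; congr (_ + _).
    rewrite mulr_sumr; apply: eq_bigr => i _; rewrite mulrA -natrM mulnC.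
    rewrite /bump /= add1n subSS divnK ?mulr_natl //.
    by rewrite prime_dvd_bin //= ltnS ltn_ord.
  by have := aux p.-1; rewrite prednK ?prime_gt0 //; apply.
elim: j => [|j [c cE]]; first by exists 0; rewrite !expr1 mulr0 addr0.
rewrite expnSr !exprM cE.
have [d ->] := step (a ^+ (p ^ j) + b ^+ (p ^ j)) (p%:R * c).
have [d' ->] := step (a ^+ (p ^ j)) (b ^+ (p ^ j)).
exists (d' + p%:R ^+ p.-1 * c ^+ p + d).
rewrite (_ : (p%:R * c) ^+ p = p%:R * (p%:R ^+ p.-1 * c ^+ p)).
  by move: ((a ^+ (p ^ j)) ^+ p) => x; ring.
by rewrite exprMn mulrA -exprS prednK ?prime_gt0.
Qed.

Variables (V : lmodType Zp) (s : {linear V -> V}) (F : V).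
Local Notation act := (poly_act s).
Implicit Types A B : {poly Zp}.

(** The action of polynomials on F makes Zp[X] F a quotient of Zp[X]: its
   annihilator is the first ideal, the annihilator of its reduction modulo p the
   second one. *)
Definition annihilates A := act A F = 0.
Definition annihilates_modp A := exists B, annihilates (A - p%:R * B).
Local Notation ann := annihilates.
Local Notation annp := annihilates_modp.

Lemma annD A B : ann A -> ann B -> ann (A + B).
Proof. by rewrite /ann poly_actD => -> ->; rewrite addr0. Qed.

Lemma annM A B : ann B -> ann (A * B).
Proof. by rewrite /ann poly_actM => ->; rewrite linear0. Qed.

Lemma ann_annp A : ann A -> annp A.
Proof. by exists 0; rewrite mulr0 subr0. Qed.

Lemma annp_p : annp p%:R.
Proof. by exists 1; rewrite mulr1 subrr /ann poly_act0. Qed.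

Lemma annpD A B : annp A -> annp B -> annp (A + B).
Proof.
move=> [A' AA] [B' BB]; exists (A' + B').
rewrite (_ : _ - _ = (A - p%:R * A') + (B - p%:R * B')); last by ring.
exact: annD.
Qed.

Lemma annpM A B : annp B -> annp (A * B).
Proof.
move=> [B' BB]; exists (A * B').
by rewrite (_ : _ - _ = A * (B - p%:R * B')); [apply: annM | ring].
Qed.

Lemma annp1_nat m : coprime p m -> annp m%:R -> annp 1.
Proof.
move=> /(Zp_nat_invertible p_pr)[b mb] /(@annpM b%:P).
by rewrite -polyC_natr -polyCM mulrC mb polyC1.
Qed.

Variable n : nat.
Hypothesis n_gt0 : (0 < n)%N.
Hypothesis sF : iter n s F = F.

Lemma ann_Xn1 : ann ('X^n - 1).
Proof. by rewrite /ann poly_actD poly_actXn sF -polyCN poly_actC scaleN1r subrr. Qed.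

(** Nakayama for the finitely generated module Zp[X].(A F): it is spanned by
   the first n iterates of s on A F. *)
Lemma ann_nakayama (d d' : Zp) A B : d * d' = 1 ->
  ann ((d%:P - p%:R * B) * A) -> ann A.
Proof.
move=> dd' annA; pose G := act A F.
have sG i : iter (i %% n) s G = iter i s G.
  have sGn : iter n s G = G.
    by rewrite -!poly_actXn /G -poly_actM mulrC poly_actM poly_actXn sF.
  rewrite {2}(divn_eq i n) addnC iterD; congr (iter _ s _).
  by elim: (i %/ n)%N => // m IH; rewrite mulSn iterD -IH sGn.
have dG : d *: G = p%:R *: act B G.
  apply/eqP; rewrite -subr_eq0; apply/eqP.
  rewrite -[RHS]annA poly_actM poly_actD poly_actC; congr (_ + _).
  by rewrite -polyC_natr -mulNr -polyCN poly_actM poly_actC scaleNr.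
suff H (i : 'I_n) : iter i s G = 0 by apply: (H (Ordinal n_gt0)).
pose a (i l : 'I_n) : Zp := d' * \sum_(j < size B | ((j + i) %% n)%N == l) B`_j.
apply: (@Zp_nakayama _ p_pr V n (fun i => iter i s G) a) => {}i.
have -> : iter i s G = d' *: (p%:R *: act B (iter i s G)).
  rewrite -!poly_actXn -[act B _]poly_actM mulrC poly_actM.
  have actZ A' c v : act A' (c *: v) = c *: act A' v by rewrite linearZ.
  by rewrite -actZ -dG actZ scalerA mulrC dd' scale1r.
rewrite scalerA mulrC -scalerA; congr (_ *: _).
under [RHS]eq_bigr => l _ do rewrite /a -scalerA scaler_suml.
rewrite -scaler_sumr; congr (_ *: _); rewrite /poly_act.
rewrite (exchange_big_dep xpredT) //=; apply: eq_bigr => j _.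
rewrite (big_pred1 (Ordinal (ltn_pmod (j + i) n_gt0))) => [|l].
  by rewrite /= sG iterD.
exact: eq_sym.
Qed.

Lemma annp1_ann1 : annp 1 -> ann 1.
Proof.
by case=> B annB; apply: (@ann_nakayama 1 1 _ B); rewrite mulr1 // polyC1.
Qed.

(** With y = X^l - 1, the relation X^n = 1 reads (m + ...) y = 0 with m = n / l,
   and m is a unit: y annihilates F because it does so modulo p.  Then X acts
   trivially on z F for z = 1 + X + ... + X^(l-1), so z (z - l) annihilates F,
   and l is a unit. *)
Lemma ann_cyclotomic l m : n = (l * m)%N -> coprime p l -> coprime p m ->
  annp (\sum_(i < l) 'X^i) -> ann (\sum_(i < l) 'X^i).
Proof.
move=> nE pl pm; set z := \sum_(i < l) _ => -[B zB].
have key (R : comPzRingType) (x : R) k : exists d, (1 + x) ^+ k - 1 = (k%:R + x * d) * x.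
  elim: k => [|k [d dE]]; first by exists 0; rewrite expr0; ring.
  exists (d + k%:R + x * d); apply: (addIr 1); rewrite subrK exprS.
  by rewrite -[(1 + x) ^+ k](subrK 1) dE -natr1; ring.
have yz : 'X^l - 1 = ('X - 1) * z by rewrite subrX1.
have ann_y : ann ('X^l - 1).
  have [b mb] := Zp_nat_invertible p_pr pm.
  have [d dE] := key _ ('X^l - 1 : {poly Zp}) m.
  apply: (@ann_nakayama _ _ _ (- (('X - 1) * B * d)) mb).
  have Xn := ann_Xn1; rewrite nE exprM -{1}['X^l](subrK 1) [_ + 1]addrC dE in Xn.
  rewrite [X in ann X](_ : _ = (m%:R + ('X^l - 1) * d) * ('X^l - 1)
             - (('X - 1) * d * ('X^l - 1)) * (z - p%:R * B)).
    by apply: annD Xn _; rewrite -mulNr; apply: annM.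
  by rewrite polyC_natr {2}yz; ring.
have [b lb] := Zp_nat_invertible p_pr pl.
apply: (@ann_nakayama _ _ _ B lb).
suff zz : ann (z * z - l%:R * z).
  rewrite [X in ann X](_ : _ = z * (z - p%:R * B) - (z * z - l%:R * z)); last first.
    by rewrite polyC_natr; ring.
  by rewrite -[- (z * z - _)]mulN1r; apply: annD; apply: annM.
have -> : z * z - l%:R * z = (\sum_(i < l) ('X^i - 1)) * z.
  by rewrite sumrB mulrBl sumr_const card_ord.
rewrite mulr_suml; apply: (big_ind ann) => [||i _].
- exact: poly_act0.
- exact: annD.
by rewrite subrX1 mulrAC -yz mulrC; apply: annM.
Qed.

Variable K : nat.
Hypothesis sK : ann (('X^2 + 1) ^+ (p ^ K) - 'X ^+ (p ^ K)).

(** By Frobenius, (X^2 + 1)^(p^j) is X^(2 p^j) + 1 modulo p. *)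
Lemma annp_sixth_root_pow j : (K <= j)%N ->
  annp (('X^(p ^ j)) ^+ 2 - 'X^(p ^ j) + 1).
Proof.
move=> Kj; have [c cE] := frobenius_pow ('X^2 : {poly Zp}) 1 j.
exists (- c).
rewrite (_ : _ - _ = ('X^2 + 1) ^+ (p ^ j) - 'X ^+ (p ^ j)); last first.
  by rewrite cE expr1n exprAC; move: ('X^(p ^ j)) => w; ring.
rewrite -(subnKC Kj) expnD !exprM.
exact: (idealX annM).
Qed.

(** Some power p^j with j >= K is 1 modulo n, and X^(p^j) then acts as X. *)
Lemma annp_sixth_root : coprime n p -> annp ('X^2 - 'X + 1).
Proof.
move=> np.
have n_tot : (0 < totient n)%N by rewrite totient_gt0.
have := annp_sixth_root_pow (leq_pmulr K n_tot); set j := (K * totient n)%N => H.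
have [q qE] : exists q, (p ^ j)%N = (q * n + 1)%N.
  have : (p ^ j == 1 %[mod n])%N.
    by rewrite /j mulnC expnM -modnXm Euler_exp_totient 1?coprime_sym // modnXm exp1n.
  have pj : (0 < p ^ j)%N by rewrite expn_gt0 prime_gt0.
  rewrite eqn_mod_dvd // => /dvdnP[q qE]; exists q.
  by rewrite -qE subnK.
have wX : annp ('X^(p ^ j) - 'X).
  rewrite qE exprD expr1 -[X in _ - X]mul1r -mulrBl mulrC mulnC exprM.
  by apply/annpM/ann_annp/(idealX1 annM)/ann_Xn1.
set w := 'X^(p ^ j) in H wX.
rewrite (_ : _ + 1 = (w ^+ 2 - w + 1) + (1 - w - 'X) * (w - 'X)); last by ring.
by apply: annpD H _; apply: annpM.
Qed.

(** In characteristic 2, X^2 - X + 1 is 1 + X + X^2. *)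
Lemma ann_cube_root : p = 2%N -> coprime n p -> (3 %| n)%N -> ann (\sum_(i < 3) 'X^i).
Proof.
move=> p2 np /dvdnP[m nE]; apply: (@ann_cyclotomic 3 m); rewrite ?p2 //.
- by rewrite nE mulnC.
- by move: np; rewrite nE coprimeMl coprime_sym p2 => /andP[].
have p2X : annp (2 *: 'X).
  by rewrite -mul_polyC mulrC polyC_natr -p2; apply/annpM/annp_p.
rewrite (_ : \sum_(i < 3) _ = ('X^2 - 'X + 1) + 2 *: 'X).
  by apply: annpD p2X; apply: annp_sixth_root.
by rewrite !big_ord_recr big_ord0 /= -mul_polyC polyC_natr; ring.
Qed.

(** In characteristic 3, X^2 = 1 and X^2 - X + 1 = 0 give X = -1. *)
Lemma ann_square_root : p = 3%N -> coprime n p -> ~~ odd n -> ann (\sum_(i < 2) 'X^i).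
Proof.
move=> p3 np n2; have n3 : ~~ (3 %| n)%N by rewrite -prime_coprime // coprime_sym -p3.
have nE : n = (2 * n./2)%N by rewrite mul2n -[LHS]odd_double_half (negbTE n2).
apply: (@ann_cyclotomic 2 n./2); rewrite ?p3 //.
  move: np; rewrite nE coprimeMl coprime_sym p3 => /andP[_].
  by rewrite coprime_sym mul2n half_double.
have phi6 := annp_sixth_root np.
have X1 : annp ('X^2 - 1).
  exact: (ideal_sqr annpD annpM phi6 (ann_annp ann_Xn1)).
have p3X : annp 3 by rewrite -p3; apply: annp_p.
rewrite (_ : \sum_(i < 2) _ = ('X^2 - 1) + (-1) * ('X^2 - 'X + 1) + 3).
  by apply: annpD p3X; apply: annpD => //; apply: annpM.
by rewrite !big_ord_recr big_ord0 /=; ring.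
Qed.

(** Three cases in which no n-th root of unity w in characteristic p satisfies
   w^2 - w + 1 = 0; here w = X^(p^K), since p may divide n. *)
Lemma ann1_odd : odd n -> p <> 2%N -> ann 1.
Proof.
move=> n_odd p2; apply: annp1_ann1; apply: (@annp1_nat 2).
  by rewrite coprime_sym prime_coprime // dvdn_prime2 //; apply/eqP => /esym.
apply: (ideal_contains_2 annpD annpM (annp_sixth_root_pow (leqnn K)) _ n_odd).
by rewrite exprAC; apply/ann_annp/(idealX1 annM)/ann_Xn1.
Qed.

Lemma ann1_prime_to_3 : p = 2%N -> odd n -> ~~ (3 %| n)%N -> ann 1.
Proof.
move=> p2 n_odd n3; apply: annp1_ann1.
apply: (ideal_contains_1 annpD annpM (annp_sixth_root_pow (leqnn K)) _ _ n3).
  by rewrite exprAC; apply/ann_annp/(idealX1 annM)/ann_Xn1.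
by rewrite -p2; apply: annp_p.
Qed.

Lemma ann1_even : ~~ odd n -> ~~ (3 %| n)%N -> p <> 3%N -> ann 1.
Proof.
move=> n2 n3 p3; apply: annp1_ann1; apply: (@annp1_nat 3).
  by rewrite coprime_sym prime_coprime // dvdn_prime2 //; apply/eqP => /esym.
apply: (ideal_contains_3 annpD annpM (annp_sixth_root_pow (leqnn K)) _ n2 n3).
by rewrite exprAC; apply/ann_annp/(idealX1 annM)/ann_Xn1.
Qed.

End Annihilator.

(** * Normal forms in the dihedral group *)

Section Dihedral.
Local Open Scope group_scope.
Variables (n : nat) (gT : finGroupType) (s t : gT).
Hypotheses (n_gt0 : (0 < n)%N) (dih : dihedral_generators n s t).

Local Notation nf a b := (s ^+ a * t ^+ (b : bool)).

Lemma dihedral_sn : s ^+ n = 1. Proof. by case: dih. Qed.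

Lemma dihedral_tt : t * t = 1. Proof. by case: dih => _ _ _ + _; rewrite expgS expg1. Qed.

Lemma dihedral_ts : t * s = s^-1 * t.
Proof. by have [_ _ _ _ <-] := dih; rewrite -!mulgA dihedral_tt mulg1. Qed.

Lemma dihedral_sts : s * t * s = t.
Proof. by rewrite -mulgA dihedral_ts mulgA mulgV mul1g. Qed.

Lemma nf_mod a b : nf (a %% n)%N b = nf a b.
Proof. by rewrite expg_mod // dihedral_sn. Qed.

Lemma nf_t a b : nf a b * t = nf a (~~ b).
Proof. by case: b; rewrite -mulgA /= ?expg1 ?expg0 ?dihedral_tt ?mulg1 ?mul1g. Qed.

Lemma nf_s a b : nf a b * s = nf (if b then a + n.-1 else a.+1)%N b.
Proof.
case: b; rewrite -mulgA /= ?expg1 ?expg0 ?mul1g ?mulg1 ?expgSr //.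
rewrite dihedral_ts mulgA expgD; congr (_ * _ * _).
by apply: (mulIg s); rewrite mulVg -expgSr prednK // dihedral_sn.
Qed.

Lemma nf_surj g : exists a b, (a < n)%N /\ g = nf a b.
Proof.
suff: exists a b, g = nf a b.
  by case=> a [b ->]; exists (a %% n)%N, b; rewrite nf_mod ltn_mod.
have /gen_prodgP[m [c cS ->]] : g \in <<[set s; t]>>.
  by have [_ -> _ _ _] := dih; rewrite inE.
elim: m c cS => [|m IH] c cS.
  by exists 0%N, false; rewrite big_ord0 mulg1.
have [i|a [b E]] := IH (fun i => c (widen_ord (leqnSn m) i)); first exact: cS.
rewrite big_ord_recr /= E; have := cS ord_max; rewrite !inE.
case/orP=> /eqP ->; rewrite ?nf_s ?nf_t; last by exists a, (~~ b).
by exists (if b then a + n.-1 else a.+1)%N, b.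
Qed.

(** There are 2 n normal forms, and they exhaust a group of order 2 n. *)
Lemma nf_inj a b a' b' : nf a b = nf a' b' -> a = a' %[mod n] /\ b = b'.
Proof.
pose F (x : 'I_n * bool) := nf (x.1 : nat) x.2.
have F_inj : {in predT &, injective F}.
  apply/image_injP; rewrite card_prod card_ord card_bool.
  rewrite (@eq_card _ _ predT) => [|g].
    by have [cG _ _ _ _] := dih; rewrite -[X in X == _]/#|gT| cG mulnC.
  have [a0 [b0 [a0n gE]]] := nf_surj g; rewrite [RHS]inE.
  by apply/fintype.imageP; exists (Ordinal a0n, b0).
move=> E; pose o i := Ordinal (ltn_pmod i n_gt0).
have FE : F (o a, b) = F (o a', b') by rewrite /F /= !nf_mod.
by have [-> ->] := F_inj _ _ isT isT FE.
Qed.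

Lemma dihedral_neq : s != t.
Proof.
apply/eqP=> st; have /nf_inj[] // : nf 1%N false = nf 0%N true.
by rewrite /= !expg1 !expg0 mulg1 mul1g.
Qed.

(** The position of s^a t^b is a - b.  Right multiplication by s and by t moves
   it by +1 and -1, in an order that depends on b. *)
Lemma dihedral_position l : (l %| n)%N -> exists pos : gT -> nat,
  (forall a, pos (s ^+ a) = a %[mod l]) /\
   forall g,
     (pos (g * s)%g = pos g + 1 %[mod l] /\ pos (g * t)%g + 1 = pos g %[mod l])%N \/
     (pos (g * t)%g = pos g + 1 %[mod l] /\ pos (g * s)%g + 1 = pos g %[mod l])%N.
Proof.
move=> ln.
have /choice[ab abP] g : exists x : nat * bool, g = nf x.1 x.2.
  by have [a [b [_ E]]] := nf_surj g; exists (a, b).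
pose pos g := ((ab g).1 + (n - (ab g).2))%N.
have posE a b : pos (nf a b) = (a + (n - b))%N %[mod l].
  have := abP (nf a b); rewrite /pos; case: (ab _) => [a' b'] /= /esym/nf_inj[E ->].
  apply/eqP; rewrite eqn_modDr; apply/eqP.
  by rewrite -[LHS](modn_dvdm _ ln) E modn_dvdm.
have n1 : (n - 1 + 1 = n)%N by rewrite subnK.
have nl : (n = 0 %[mod l])%N by rewrite mod0n; apply/eqP.
exists pos; split=> [a|].
  by have := posE a false; rewrite mulg1 subn0 -modnDmr nl mod0n addn0.
move=> g; have [a [b [_ ->]]] := nf_surj g; rewrite nf_s nf_t.
have posE1 a' b' : (pos (nf a' b') + 1 = a' + (n - b') + 1 %[mod l])%N.
  by rewrite -modnDml posE modnDml.
case: b; [right | left]; rewrite !(posE, posE1) /= ?subn0.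
  split; first by rewrite -addnA n1.
  by rewrite -addnA n1 -modnDmr nl mod0n addn0 subn1.
by rewrite addn1 addSn; split=> //; rewrite -addnA n1.
Qed.

End Dihedral.

(** * Spans and maps out of quotients, tensor products and Bowen-Franks modules *)

Section UniversalProperty.
Local Open Scope ring_scope.

Lemma span_sum (R : nzRingType) (V : lmodType R) r (e : 'I_r -> V) x :
  Defs.span (fun y => exists j, y = e j) x -> exists a, x = \sum_j a j *: e j.
Proof.
elim=> [|c y z [j ->] _ [a ->]].
  by exists (fun _ => 0); rewrite big1 // => j _; rewrite scale0r.
exists (fun i => c * (i == j)%:R + a i).
under [RHS]eq_bigr => i _ do rewrite scalerDl.
rewrite big_split /=; congr (_ + _).
rewrite (bigD1 j) //= eqxx mulr1 big1 ?addr0 // => i /negbTE ->.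
by rewrite mulr0 scale0r.
Qed.

Lemma span_add_sum (R : nzRingType) (V : lmodType R) (S : V -> Prop) r (f : 'I_r -> V) :
  (forall j, Defs.span S (f j)) -> Defs.span S (\sum_j f j).
Proof.
move=> Sf; apply: (big_ind (Defs.span S)) => [|x y|j _]; last exact: Sf.
  exact: span_zero.
exact: spanD.
Qed.

Lemma quotmod_lift (R : nzRingType) (V W : lmodType R) (S : V -> Prop)
    (f : {linear V -> W}) : (forall v, S v -> f v = 0) ->
  exists F : {linear quotmod S -> W}, forall v, F (qproj S v) = f v.
Proof.
move=> fS; pose F (x : quotmod S) := f (qrepr x).
have FE v : F (qproj S v) = f v.
  apply/eqP; rewrite -subr_eq0 -linearB; apply/eqP.
  have : Defs.span S (qrepr (qproj S v) - v) by apply/qprojP; rewrite qreprK.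
  elim=> [|a x y Sx _ IH]; first exact: linear0.
  by rewrite linearP fS // IH scaler0 addr0.
have Flin : linear F.
  by move=> a x y; rewrite -[x]qreprK -[y]qreprK -(linearP (qproj S)) !FE linearP.
by exists (mk_linear Flin).
Qed.

Lemma tensor_lift (R : comNzRingType) (A : zmodType) (W : lmodType R)
    (f : A -> W) : (forall a b, f (a + b) = f a + f b) ->
  exists F : {linear tensor R A -> W}, forall a, F (pure_tensor R a) = f a.
Proof.
move=> fD; have [|F FE] := @quotmod_lift R _ W (@tensor_rel R A) (fgext f).
  by move=> D [a [b ->]]; rewrite !linearB !fgextU fD addrAC addrK subrr.
by exists F => a; rewrite [LHS]FE fgextU.
Qed.

(** Additive maps out of the Bowen-Franks module are the functions on the
   vertices whose value at v is the sum of the values at the ends of the edges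
   leaving v. *)
Lemma BF_lift (Y : digraph) (W : zmodType) (h : vertex Y -> W) :
  (forall v, h v = \sum_(e : edge Y | origin e == v) h (terminus e)) ->
  exists F : BF Y -> W, (forall a b, F (a + b) = F a + F b) /\
    forall v, F (qproj _ << v >>) = h v.
Proof.
move=> hE; pose f : {linear Div Y -> ssrint.zmodule W} := fgext (h : vertex Y -> ssrint.zmodule W).
have [|F FE] := @quotmod_lift _ _ _ (fun D : Div Y => exists D', D = D' - adjop D') f.
  move=> D [D' ->]; rewrite linearB; apply/eqP; rewrite subr_eq0; apply/eqP.
  pose g : {linear Div Y -> ssrint.zmodule W} := f \o @adjop Y.
  apply: (@eq_fgext _ _ _ f g) => v.
  transitivity (f (\sum_(e : edge Y | origin e == v) << terminus e >>)).
    by rewrite linear_sum [LHS]fgextU hE; apply: eq_bigr => e _; rewrite [RHS]fgextU.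
  by congr (f _); rewrite [RHS]fgextU.
exists F; split=> [a b|v]; first exact: linearD.
by rewrite [LHS]FE [LHS]fgextU.
Qed.

Lemma BF_adjacency (Y : digraph) (v : vertex Y) :
  qproj _ << v >> = \sum_(e : edge Y | origin e == v) qproj _ << terminus e >> :> BF Y.
Proof.
rewrite -(linear_sum (qproj (fun D : Div Y => exists D', D = D' - adjop D'))).
apply/qprojP/spanS; exists (<< v >> : Div Y).
by congr (_ - _); rewrite [RHS]fgextU.
Qed.

End UniversalProperty.

(** * Vertex classes in the layers of the Cayley graph *)

Section CayleyLayer.
Local Open Scope ring_scope.
Variables (n : nat) (gT : finGroupType) (s t : gT).
Hypotheses (n_gt0 : (0 < n)%N) (dih : dihedral_generators n s t).
Variables (p : nat) (p_pr : prime p) (m0 : nat).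
Local Notation X := (cayley [set s; t]).
Variable x0 : vertex (layer p X m0).
Local Notation Zp := (Defs.Zp p_pr).
Local Notation P k := (p ^ (m0 + k))%N.
Local Notation M k := (BFZp p_pr x0 k).

(** The second coordinate is any natural number, read modulo P k: a step along an
   edge is then a plain successor. *)
Definition layer_vertex k (g : gT) (i : nat) : vertex (layer p X (m0 + k)) :=
  (g, Ordinal (ltn_pmod i (ppow_gt0 p_pr (m0 + k)))).

(** The class of a vertex of the component, and 0 elsewhere: with this extension
   the relations between the classes hold for all g and i. *)
Definition vclass k (g : gT) (i : nat) : M k :=
  if insub (layer_vertex k g i) is Some v then BFZp_pure (v : vertex (clayer p_pr x0 k)) else 0.

Lemma vclass_mod k g i : vclass k g (i %% P k) = vclass k g i.
Proof.
rewrite /vclass (_ : layer_vertex k g _ = layer_vertex k g i) //.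
by congr pair; apply: val_inj; rewrite /= modn_mod.
Qed.

Lemma vclassE k (v : vertex (clayer p_pr x0 k)) : vclass k (val v).1 (val v).2 = BFZp_pure v.
Proof.
rewrite /vclass (_ : layer_vertex _ _ _ = val v) ?valK //.
by rewrite [RHS]surjective_pairing; congr pair; apply: val_inj; rewrite /= modn_small.
Qed.

Lemma above_step k g i a : a \in [set s; t]%SET ->
  (layer_vertex k (g * a)%g i.+1 \in above p_pr x0 k) = (layer_vertex k g i \in above p_pr x0 k).
Proof.
move=> aS; pose e : edge (layer p X (m0 + k)) :=
  ((g, exist _ a aS), Ordinal (ltn_pmod i (ppow_gt0 p_pr (m0 + k)))).
have -> : layer_vertex k (g * a)%g i.+1 = terminus e.
  by congr pair; apply: val_inj; rewrite /= -addn1 -modnDml addn1.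
by rewrite -above_closed.
Qed.

Lemma sum_out_edges k (W : nmodType) (F : gT -> nat -> W) (v : vertex (clayer p_pr x0 k)) :
  (forall g i, F g (i %% P k)%N = F g i) ->
  \sum_(e : edge (clayer p_pr x0 k) | origin e == v)
      F (val (terminus e)).1 (val (terminus e)).2
  = F ((val v).1 * s)%g (val v).2.+1 + F ((val v).1 * t)%g (val v).2.+1.
Proof.
move=> FE; pose lab (e : edge (clayer p_pr x0 k)) : gT := val (val e).1.2.
rewrite (partition_big lab (mem [set s; t]%SET)) /= => [|e _]; last exact: (valP (val e).1.2).
rewrite [LHS](_ : _ = \sum_(a in [set s; t]%SET) F ((val v).1 * a)%g (val v).2.+1).
  by rewrite big_setU1 ?inE ?(dihedral_neq n_gt0 dih) // big_set1.
apply: eq_bigr => a aS.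
pose e0 : edge (layer p X (m0 + k)) := (((val v).1, exist _ a aS), (val v).2).
have oe0 : origin e0 = val v by rewrite [RHS]surjective_pairing.
have e0P : (origin e0 \in above p_pr x0 k) && (terminus e0 \in above p_pr x0 k).
  by rewrite -above_closed andbb oe0 (valP v).
rewrite (big_pred1 (Sub e0 e0P)) => [|e].
  by rewrite /= FE.
rewrite [RHS]/= -val_eqE -[in RHS]val_eqE /= /lab; change (\val e) with (sval e).
move: (sval e) => [[g a'] i] /=; rewrite /e0 [sval v]surjective_pairing /=.
rewrite -!pair_eqE /= /pair_eq /= -[in RHS]pair_eqE /= /pair_eq /= -[a' == _]val_eqE /=.
by rewrite andbAC.
Qed.

(** Edges do not leave the component, so both sides vanish outside of it. *)
Lemma vclass_rec k g i : vclass k g i = vclass k (g * s)%g i.+1 + vclass k (g * t)%g i.+1.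
Proof.
rewrite {1}/vclass; case: insubP => [v _ vE|out].
  rewrite /BFZp_pure BF_adjacency raddf_sum.
  transitivity (\sum_(e : edge (clayer p_pr x0 k) | origin e == v)
      vclass k (val (terminus e)).1 (val (terminus e)).2).
    by apply: eq_bigr => e _; rewrite vclassE.
  rewrite sum_out_edges; last exact: vclass_mod.
  have succ g' : vclass k g' (i %% P k).+1 = vclass k g' i.+1.
    by rewrite -vclass_mod -addn1 modnDml addn1 vclass_mod.
  by rewrite vE /= !succ.
have out' a : a \in [set s; t]%SET -> vclass k (g * a)%g i.+1 = 0.
  by move=> aS; rewrite /vclass insubN // above_step.
by rewrite !out' ?inE ?eqxx ?orbT // addr0.
Qed.

Lemma vclass_period k g i j : vclass k g (i + j * P k) = vclass k g i.
Proof. by rewrite -vclass_mod addnC modnMDl vclass_mod. Qed.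

(** The projection modulo the span of S agrees with 0 on the vertex classes, and
   linear maps are determined by their values on these. *)
Lemma BFZp_span k (S : M k -> Prop) :
  (forall g i, Defs.span S (vclass k g i)) -> forall x, Defs.span S x.
Proof.
move=> SE x; rewrite -[x]subr0; apply/qprojP.
have lin0 : linear (fun _ : M k => 0 : quotmod S) by move=> a u v; rewrite scaler0 addr0.
rewrite [RHS]linear0; apply: (@eq_BFZp _ _ _ _ _ _ _ (qproj S) (mk_linear lin0)) => v.
rewrite [RHS]/= -[RHS](linear0 (qproj S)); apply/qprojP; rewrite subr0 -vclassE.
exact: SE.
Qed.

Lemma vclass_functional k (W : lmodType Zp) (h : gT -> nat -> W) :
  (forall g i, h g (i %% P k)%N = h g i) ->
  (forall g i, h g i = h (g * s)%g i.+1 + h (g * t)%g i.+1) ->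
  exists f : {linear M k -> W}, forall g i,
    layer_vertex k g i \in above p_pr x0 k -> f (vclass k g i) = h g i.
Proof.
move=> h_mod h_rec.
pose h' (v : vertex (clayer p_pr x0 k)) := h (val v).1 (val v).2.
have [|F [FD FE]] := @BF_lift (clayer p_pr x0 k) W h'.
  by move=> v; rewrite [RHS]sum_out_edges // /h' h_rec.
have [f fE] := tensor_lift FD; exists f => g i gi.
by rewrite /vclass insubT fE FE /h' SubK /= h_mod.
Qed.

Lemma vclass_gen k g i : BFZp_gen p_pr x0 k (vclass k g i) = vclass k g (i + p ^ m0).
Proof.
have dE : layer_vertex k g (i + p ^ m0) = deck (layer_vertex k g i).
  by congr pair; apply: val_inj; rewrite /= val_iter_ordS /= modnDml.
rewrite {1}/vclass; case: insubP => [v v_in vE|out].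
  by rewrite [LHS]BFZp_gen_pure -vclassE -[val (cdeck v)]/(deck (val v)) vE -dE /= vclass_mod.
by rewrite linear0 /vclass insubN // dE deck_above.
Qed.

Lemma layer_vertex_proj k g i :
  layer_proj p_pr (m0 + k) (layer_vertex k.+1 g i) = layer_vertex k g i.
Proof.
by congr pair; apply: val_inj; rewrite /= modn_dvdm // dvdn_exp2l // leq_add2l.
Qed.

Lemma above_proj k g i : (layer_vertex k.+1 g i \in above p_pr x0 k.+1)
  = (layer_vertex k g i \in above p_pr x0 k).
Proof. by rewrite -[in RHS]layer_vertex_proj !inE /layer_proj /= ord_red_red ?leq_addr. Qed.

Lemma vclass_proj k g i : BFZp_proj p_pr x0 k (vclass k.+1 g i) = vclass k g i.
Proof.
rewrite {1}/vclass; case: insubP => [v v_in vE|out].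
  rewrite [LHS]BFZp_proj_pure -vclassE.
  rewrite -[val (clayer_proj v)]/(layer_proj p_pr (m0 + k) (val v)) vE.
  by rewrite layer_vertex_proj /= vclass_mod.
by rewrite linear0 /vclass insubN // -above_proj.
Qed.

Lemma above_base k : layer_vertex k x0.1 x0.2 \in above p_pr x0 k.
Proof.
rewrite inE (_ : layer_proj p_pr m0 _ = x0) ?inE ?connect0 //.
rewrite [RHS]surjective_pairing; congr pair; apply: val_inj => /=.
by rewrite modn_dvdm ?dvdn_exp2l ?leq_addr // modn_small.
Qed.

(** These vertices lie in the component: they are reached from the base point
   along edges labelled s. *)
Lemma above_rotate k j : layer_vertex k (x0.1 * s ^+ j)%g (x0.2 + j) \in above p_pr x0 k.
Proof.
elim: j => [|j IH]; first by rewrite addn0 mulg1 above_base.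
by rewrite expgSr mulgA addnS above_step // set21.
Qed.

End CayleyLayer.

(** * Right translation of functions on a group *)

Section RightShift.
Local Open Scope ring_scope.
Variables (gT : finGroupType) (s : gT) (R : comNzRingType) (V : lmodType R).

Definition right_shift_fun (F : {ffun gT -> V}) : {ffun gT -> V} :=
  [ffun g => F (g * s)%g].

Lemma right_shift_is_linear : linear right_shift_fun.
Proof. by move=> a F G; apply/ffunP => g; rewrite !ffunE. Qed.

Definition right_shift : {linear {ffun gT -> V} -> {ffun gT -> V}} :=
  mk_linear right_shift_is_linear.

Lemma iter_right_shift j F g : iter j right_shift F g = F (g * s ^+ j)%g.
Proof.
elim: j g => [|j IH] g; first by rewrite mulg1.
by rewrite iterS [LHS]ffunE IH -mulgA -expgS.
Qed.

Lemma right_shift_geometric l F g :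
  poly_act right_shift (\sum_(j < l) 'X^j) F g = \sum_(j < l) F (g * s ^+ j)%g.
Proof.
elim: l => [|l IH]; first by rewrite !big_ord0 poly_act0 ffunE.
by rewrite !big_ord_recr poly_actD ffunE IH poly_actXn iter_right_shift.
Qed.

End RightShift.

(** * The tower of the dihedral Cayley graph *)

Section CayleyTower.
Local Open Scope ring_scope.
Variables (n : nat) (gT : finGroupType) (s t : gT).
Hypotheses (n_gt0 : (0 < n)%N) (dih : dihedral_generators n s t).
Variables (p : nat) (p_pr : prime p) (m0 : nat).
Local Notation X := (cayley [set s; t]).
Variable x0 : vertex (layer p X m0).
Local Notation Zp := (Defs.Zp p_pr).
Local Notation P k := (p ^ (m0 + k))%N.
Local Notation vclass := (vclass p_pr x0).
Local Notation ann := (annihilates (right_shift s _)).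
Let recE k g i : vclass k g i = vclass k (g * s)%g i.+1 + vclass k (g * t)%g i.+1 :=
  vclass_rec n_gt0 dih p_pr x0 k g i.

(** The two edges leaving g s t have the same ends as the two edges leaving g. *)
Lemma vclass_st k g i : vclass k (g * s * t)%g i = vclass k g i.
Proof.
rewrite recE addrC [RHS]recE -!mulgA (dihedral_tt dih) mulg1; congr (_ + _).
by rewrite [(s * (t * s))%g]mulgA (dihedral_sts dih).
Qed.

Lemma vclass_t k g i : vclass k (g * t)%g i = vclass k (g * s^-1)%g i.
Proof. by rewrite -[RHS]vclass_st mulgKV. Qed.

Definition vclass_fun k i : {ffun gT -> BFZp p_pr x0 k} := [ffun g => vclass k g i].

(** Translation by s turns [g, i] = [g s, i+1] + [g s^-1, i+1] into the equality
   of X with X^2 + 1 followed by a step i |-> i+1; it is iterated j times. *)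
Lemma vclass_fun_shift k i j :
  poly_act (right_shift s _) 'X^j (vclass_fun k i)
  = poly_act (right_shift s _) (('X^2 + 1) ^+ j) (vclass_fun k (i + j)).
Proof.
have shift1 i' : right_shift s _ (vclass_fun k i')
    = poly_act (right_shift s _) ('X^2 + 1) (vclass_fun k i'.+1).
  apply/ffunP => g; rewrite poly_actD poly_actXn -polyC1 poly_actC scale1r.
  rewrite [RHS]ffunE iter_right_shift !ffunE recE vclass_st.
  by rewrite expgS expg1 mulgA.
elim: j i => [|j IH] i; first by rewrite addn0 !expr0.
rewrite exprSr poly_actMX shift1 -poly_actM mulrC poly_actM IH -poly_actM.
by rewrite -exprS addSnnS.
Qed.

Lemma vclass_fun_order k i : iter n (right_shift s _) (vclass_fun k i) = vclass_fun k i.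
Proof. by apply/ffunP => g; rewrite iter_right_shift (dihedral_sn dih) mulg1. Qed.

(** After P k steps the second coordinate has come back to i. *)
Lemma vclass_fun_full_turn k i :
  ann (vclass_fun k i) (('X^2 + 1) ^+ P k - 'X ^+ P k).
Proof.
rewrite /annihilates poly_actD -mulN1r poly_actM vclass_fun_shift.
have -> : vclass_fun k (i + P k) = vclass_fun k i.
  by apply/ffunP => g; rewrite !ffunE -[X in (_ + X)%N]mul1n vclass_period.
by rewrite -polyCN poly_actC scaleN1r subrr.
Qed.

Lemma vclass_geometric l k g i :
  ann (vclass_fun k i) (\sum_(j < l) 'X^j) -> \sum_(j < l) vclass k (g * s ^+ j)%g i = 0.
Proof.
move/(congr1 (fun F : {ffun _ -> _} => F g)).
rewrite right_shift_geometric ffunE => E; rewrite -[RHS]E.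
by apply: eq_bigr => j _; rewrite ffunE.
Qed.

Lemma annihilated_invariants : (forall k i, ann (vclass_fun k i) 1) ->
  iwasawa_invariants (BF_infty p_pr x0) 0 0.
Proof.
move=> ann1.
have v0 k g i : vclass k g i = 0.
  have /(congr1 (fun F : {ffun _ -> _} => F g)) := ann1 k i.
  by rewrite -polyC1 poly_actC scale1r !ffunE.
apply: (@scalar_tower_invariants p p_pr (BF_tower p_pr x0) 0 1 (fun k _ => 0)).
- by exists 0; rewrite mulr0 addr0.
- by move=> k [].
- by move=> k [].
- move=> k x; exists (fun _ => 0); rewrite big_ord0.
  have : Defs.span (fun _ => False) (x : BFZp p_pr x0 k).
    by apply: BFZp_span => g i; rewrite v0; apply: span_zero.
  by elim.
- by move=> k a _ [].
Qed.

(* The functions (g, i) |-> chi j (pos g) u^i satisfy the relations between the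
   vertex classes up to the period of u^i: they serve as coordinate forms for
   the classes of the vertices (g0 s^j, i0 + j), where (g0, i0) is the base
   point.  The shift of i0 by j keeps these vertices in its component. *)
Variables (l : nat) (u : Zp) (chi : 'I_l -> nat -> Zp).
Hypothesis ln : (l.+1 %| n)%N.
Hypothesis u1 : exists c, u = 1 + p%:R * c.
Hypothesis vclass_sum : forall k g i, \sum_(j < l.+1) vclass k (g * s ^+ j)%g i = 0.
Hypothesis vclass_next : forall k g i, vclass k g i.+1 = u *: vclass k g i.
Hypothesis chi_mod : forall j a b, a = b %[mod l.+1] -> chi j a = chi j b.
Hypothesis chi_rec : forall j a, chi j a.+1 = u * (chi j a.+2 + chi j a).
Hypothesis chi_delta : forall i j : 'I_l, chi j i * u ^+ i = (i == j)%:R.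

Let e k (j : 'I_l) : BFZp p_pr x0 k := vclass k (x0.1 * s ^+ j)%g (x0.2 + j).

Lemma vclass_iter k g i j : vclass k g (i + j) = u ^+ j *: vclass k g i.
Proof.
elim: j => [|j IH]; first by rewrite addn0 scale1r.
by rewrite addnS vclass_next IH scalerA exprS.
Qed.

(** The classes with second coordinate i are multiples of those with any other
   one, since i may be increased by multiples of P k; the vanishing sums express
   s^a through the preceding powers of s, and t acts on the right as s^-1. *)
Lemma vclass_span k x : exists a, x = \sum_j a j *: e k j.
Proof.
apply: span_sum; apply: BFZp_span => g i; set S := fun y => _.
have pure_s a : Defs.span S (vclass k (x0.1 * s ^+ a)%g i).
  elim/ltn_ind: a => a IH; case: (ltnP a l) => [al|la].
    rewrite -(vclass_period p_pr x0 k _ i (x0.2 + a)).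
    have le_i : (x0.2 + a <= i + (x0.2 + a) * P k)%N.
      by rewrite (leq_trans _ (leq_addl _ _)) // leq_pmulr // expn_gt0 prime_gt0.
    rewrite -(subnKC le_i) vclass_iter; apply: spanZ; apply: spanS.
    by exists (Ordinal al).
  (* The last of these l + 1 consecutive terms is the class of s^a. *)
  have := vclass_sum k (x0.1 * s ^+ (a - l))%g i.
  rewrite big_ord_recr /= -mulgA -expgD subnK // addrC => /eqP.
  rewrite addr_eq0 => /eqP ->; apply: spanN; apply: span_add_sum => j.
  rewrite -mulgA -expgD; apply: IH.
  by rewrite -[X in (_ < X)%N](subnK la) ltn_add2l.
have [a [b [_ gE]]] := nf_surj n_gt0 dih (x0.1^-1 * g)%g.
rewrite (_ : g = (x0.1 * (s ^+ a * t ^+ b))%g); last by rewrite -gE mulKVg.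
case: b {gE} => /=; last by rewrite expg0 mulg1.
rewrite expg1 mulgA vclass_t -mulgA.
suff -> : (s ^+ a * s^-1 = s ^+ (a + n.-1))%g by [].
rewrite expgD; congr (_ * _)%g; apply: (mulIg s).
by rewrite mulVg -expgSr prednK // (dihedral_sn dih).
Qed.

(** The forms (g, i) |-> chi j (pos g) u^i are well defined with values modulo
   1 - u^(P k), where u^i depends on i modulo P k only. *)
Lemma vclass_free k (a : 'I_l -> Zp) : \sum_i a i *: e k i = 0 ->
  forall i, exists b, a i = b * (1 - u ^+ P k).
Proof.
move=> a0 j; pose W := quotmod (fun x : Zp^o => x = 1 - u ^+ P k).
pose one : W := qproj _ (1 : Zp^o).
have oneE (c : Zp) : c *: one = qproj _ (c : Zp^o).
  by rewrite -linearZ /= [_ *: _]mulr1.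
have uP : u ^+ P k *: one = one.
  rewrite oneE; apply/qprojP; rewrite -[u ^+ P k - 1]opprB.
  by apply: spanN; apply: spanS; rewrite ?opprB.
have u_mod i c : u ^+ (i %% P k + c) *: one = u ^+ (i + c) *: one.
  rewrite {2}(divn_eq i (P k)) -addnA [(_ * P k + _)%N]addnC [in RHS]exprD -[in RHS]scalerA.
  rewrite [(_ * P k)%N]mulnC exprM; congr (_ *: _).
  by elim: (i %/ _)%N => [|q IH]; rewrite ?scale1r // exprSr -scalerA uP.
have [pos [pos_s pos_rec]] := dihedral_position n_gt0 dih ln.
(* The exponent is i - i0 modulo P k, written without subtracting i0 from i. *)
pose h g i : W := (chi j (pos (x0.1^-1 * g)%g) * u ^+ (i + (P k - x0.2))) *: one.
have [||f fE] := @vclass_functional n gT s t n_gt0 dih p p_pr m0 x0 k W h.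
- by move=> g i; rewrite /h -!scalerA u_mod.
- move=> g i; rewrite /h -scalerDl !mulgA addSn exprS; congr (_ *: _).
  set c := chi j (pos _).
  suff -> : c = u * (chi j (pos (x0.1^-1 * g * s)%g) + chi j (pos (x0.1^-1 * g * t)%g)).
    by move: (u ^+ _) => U; ring.
  rewrite {}/c; move: (pos_rec (x0.1^-1 * g)%g); move: (pos _) (pos _) (pos _) => y z w.
  by case=> -[E1 E2]; move: E1; rewrite -modnDml -E2 modnDml -addnA => E1;
    rewrite -(chi_mod _ E2) addn1 (chi_mod _ E1) chi_rec addn2 1?addrC.
have fe i : f (e k i) = (i == j)%:R *: one.
  rewrite fE ?above_rotate // /h mulKg (chi_mod _ (pos_s i)) addnAC subnKC; last first.
    by rewrite ltnW // (leq_trans (ltn_ord _)) // leq_exp2l ?prime_gt1 // leq_addr.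
  by rewrite exprD mulrCA mulrC -scalerA uP chi_delta.
have /(congr1 f) := a0; rewrite linear0 linear_sum (bigD1 j) //= big1 ?addr0 => [|i ij].
  rewrite linearZ /= fe eqxx scale1r oneE -[RHS](linear0 (qproj _)).
  move/qprojP; rewrite subr0.
  elim=> [|b x y -> _ [c ->]]; first by exists 0; rewrite mul0r.
  by exists (b + c); rewrite mulrDl.
by rewrite linearZ /= fe (negbTE ij) scale0r scaler0.
Qed.

(** The generator of Gamma' makes p^m0 steps, hence acts as u^(p^m0). *)
Theorem cyclotomic_invariants : iwasawa_invariants (BF_infty p_pr x0) 0 l.
Proof.
apply: (@scalar_tower_invariants p p_pr (BF_tower p_pr x0) l (u ^+ (p ^ m0)) e).
- exact: unipotent_pow_modp.
- by move=> k i; apply: vclass_proj.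
- by move=> k i; rewrite [LHS]vclass_gen vclass_iter.
- exact: vclass_span.
- by move=> k a a0; rewrite -exprM -expnD; apply: vclass_free.
Qed.

End CayleyTower.

(** * The two cases with a nonzero limit *)

Section DihedralCases.
Local Open Scope ring_scope.
Variables (n : nat) (gT : finGroupType) (s t : gT).
Hypotheses (n_gt0 : (0 < n)%N) (dih : dihedral_generators n s t).
Variables (p : nat) (p_pr : prime p) (m0 : nat).
Variable x0 : vertex (layer p (cayley [set s; t]) m0).
Local Notation Zp := (Defs.Zp p_pr).
Local Notation vclass := (vclass p_pr x0).
Local Notation sF k i := (vclass_fun_order dih p_pr x0 k i).
Local Notation sK k i := (vclass_fun_full_turn n_gt0 dih p_pr x0 k i).

Lemma vclass_rec_s k g i :
  vclass k g i = vclass k (g * s)%g i.+1 + vclass k (g * s^-1)%g i.+1.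
Proof. by rewrite (vclass_rec n_gt0 dih) (vclass_t n_gt0 dih). Qed.

(** From 1 + X + X^2 = 0, X + X^-1 = -1 and u = -1.  The coordinate forms are two
   independent sequences of period 3 with the sum of any three consecutive terms
   equal to 0. *)
Lemma invariants_at_2 : p = 2%N -> odd n -> (3 %| n)%N ->
  iwasawa_invariants (BF_infty p_pr x0) 0 2.
Proof.
move=> p2 n_odd n3.
have np : coprime n p by rewrite p2 coprimen2.
have sum3 k g i : \sum_(j < 3) vclass k (g * s ^+ j)%g i = 0.
  exact/vclass_geometric/(ann_cube_root n_gt0 (sF k i) (sK k i)).
pose chi (j : 'I_2) (a : nat) : Zp :=
  nth 0 (if j == 0 :> nat then [:: 1; 0; -1] else [:: 0; -1; 1]) (a %% 3).
apply: (@cyclotomic_invariants n gT s t n_gt0 dih p p_pr m0 x0 2 (-1) chi) => //.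
- by exists (-1); rewrite (congr1 (fun m => m%:R : Zp) p2); ring.
- move=> k g i; (* The three terms at g s^-1, g and g s. *)
  have := sum3 k (g * s^-1)%g i.+1.
  rewrite !big_ord_recr big_ord0 /= add0r !(mulg1, expg1) expgS expg1 mulgKV.
  rewrite mulgA mulgKV scaleN1r (vclass_rec_s k g i) => E.
  by apply/eqP; rewrite -addr_eq0 addrC [X in X + _]addrC addrAC E.
- by move=> j a b ab; rewrite /chi ab.
- move=> j a; rewrite /chi -[a.+2]addn2 -[a.+1]addn1 -(modnDml a 1) -(modnDml a 2).
  case: ifP => _; case: (a %% 3)%N (ltn_pmod a (isT : 0 < 3)%N) => [|[|[|]]] //= _; ring.
by case=> [[|[|]]] // ? [[|[|]]] // ?; rewrite /chi /=; ring.
Qed.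

(** From X = -1, X + X^-1 = -2 and u = -1/2. *)
Lemma invariants_at_3 : p = 3%N -> ~~ odd n -> ~~ (3 %| n)%N ->
  iwasawa_invariants (BF_infty p_pr x0) 0 1.
Proof.
move=> p3 n_even n3.
have np : coprime n p by rewrite coprime_sym p3 prime_coprime.
have sum2 k g i : \sum_(j < 2) vclass k (g * s ^+ j)%g i = 0.
  exact/vclass_geometric/(ann_square_root n_gt0 (sF k i) (sK k i)).
have [|b b2] := @Zp_nat_invertible p p_pr 2; first by rewrite p3.
have vs k g i : vclass k (g * s)%g i = - vclass k g i.
  have := sum2 k g i; rewrite !big_ord_recr big_ord0 /= add0r mulg1 expg1 addrC.
  by move/eqP; rewrite addr_eq0 => /eqP.
pose chi (j : 'I_1) (a : nat) : Zp := (-1) ^+ a.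
apply: (@cyclotomic_invariants n gT s t n_gt0 dih p p_pr m0 x0 1 (- b) chi) => //.
- by rewrite /dvdn modn2 (negbTE n_even).
- by exists (- b); rewrite (congr1 (fun m => m%:R : Zp) p3) -{1}b2; ring.
- move=> k g i; have vs' : vclass k (g * s^-1)%g i.+1 = - vclass k g i.+1.
    by rewrite -[in RHS](mulgKV s g) vs opprK.
  rewrite (vclass_rec_s k g i) vs vs' -opprD -mulr2n scalerN scaleNr opprK.
  by rewrite -scaler_nat scalerA mulrC b2 scale1r.
- move=> j a c ac; rewrite /chi -(signr_odd _ a) -(signr_odd _ c); congr (_ ^+ _).
  by move: ac; rewrite !modn2; case: (odd a) (odd c) => [] [].
- move=> j a; rewrite /chi !exprS.
  transitivity (- (-1) ^+ a * (2 * b)); first by rewrite b2 mulr1 mulN1r.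
  by move: ((-1) ^+ a) => x; ring.
- by move=> i j; rewrite !ord1 /chi !mulr1.
Qed.

End DihedralCases.

Theorem proposition3p5 (n : nat) (gT : finGroupType) (sigma tau : gT)
    (n_gt0 : (0 < n)%N) (dih : dihedral_generators n sigma tau) :
  (odd n ->
    forall (p : nat) (p_pr : prime p) (m0 : nat),
    stabilization_index p (cayley [set sigma; tau]) m0 ->
    forall x0 : vertex (layer p (cayley [set sigma; tau]) m0),
      (p <> 2%N -> iwasawa_invariants (BF_infty p_pr x0) 0 0)
      /\ (p = 2%N ->
          iwasawa_invariants (BF_infty p_pr x0) 0 (if (3 %| n)%N then 2 else 0)))
  /\ (~~ odd n -> ~~ (3 %| n)%N ->
    forall (p : nat) (p_pr : prime p) (m0 : nat),
    stabilization_index p (cayley [set sigma; tau]) m0 ->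
    forall x0 : vertex (layer p (cayley [set sigma; tau]) m0),
      (p <> 3%N -> iwasawa_invariants (BF_infty p_pr x0) 0 0)
      /\ (p = 3%N -> iwasawa_invariants (BF_infty p_pr x0) 0 1)).
Proof.
split=> [n_odd|n_even n3] p p_pr m0 _ x0;
  have sF k i := vclass_fun_order dih p_pr x0 k i;
  have sK k i := vclass_fun_full_turn n_gt0 dih p_pr x0 k i.
  split=> [p2|p2]; last case: ifPn => n3.
  - by apply: annihilated_invariants => k i; exact: (ann1_odd n_gt0 (sF k i) (sK k i)).
  - exact: (invariants_at_2 n_gt0 dih).
  - apply: annihilated_invariants => k i.
    exact: (ann1_prime_to_3 n_gt0 (sF k i) (sK k i)).
split=> p3; last exact: (invariants_at_3 n_gt0 dih).
by apply: annihilated_invariants => k i; exact: (ann1_even n_gt0 (sF k i) (sK k i)).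
Qed.
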